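(* Let $x,z$ be nonnegative integers with $x\not\equiv z\pmod 2$, let $\mathbf a=(a_1,\dots,a_m)$, $\mathbf b=(b_1,\dots,b_n)$, $\mathbf c=(c_1,\dots,c_k)$ be sequences of nonnegative integers with $m,n,k$ positive even integers, and let $y$ be an integer with $y\ge 0$ if $a\le b$ and $y\ge -1$ if $a>b$. Put $g=\lfloor\frac{x+z}{2}\rfloor$, $g'=\lceil\frac{x+z}{2}\rceil$, $\mu=\max(a,b)$, $\nu=\min(a,b)$. Then \begin{align*} \operatorname{M}(R^{\swarrow}_{x,y,z}(\mathbf a;\mathbf c;\mathbf b))=&\operatorname{M}(C_{x,2y+z+2\mu+1,z}(c))\\ &\times s\left(y+1+b-\nu,a_1,\dots,a_m,g,c_1,\dots,c_{k-1},c_k+g'+b_n,b_{n-1},\dots,b_1\right)\\ &\times s\left(a_1,\dots,a_{m-1},a_m+g+c_1,c_2,\dots,c_k,g',b_n,\dots,b_1,y+a-\nu\right)\\ &\times\frac{\operatorname{H}(c+g)}{\operatorname{H}(c)\operatorname{H}(g)}\frac{\operatorname{H}(\mu+y+g')}{\operatorname{H}(\mu+c+y+g')}\\ &\times \frac{\operatorname{H}(\mu+y+z)\operatorname{H}(\mu+c+y+z+1)}{\operatorname{H}(\mu-o_a+o_b+o_c+y+z+1)\operatorname{H}(\mu+o_a-o_b+e_c+y+z)}\\ &\times \frac{\operatorname{H}(\mu-o_a+o_b+o_c+y+1)\operatorname{H}(\mu+o_a-o_b+e_c+y)}{\operatorname{H}(\mu+y)\operatorname{H}(\mu+y+1)}.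 \end{align*}
   Context: Work on the triangular lattice drawn with horizontal lattice lines. A lozenge is the union of two unit triangles sharing an edge; a (lozenge) tiling of a region is a covering by lozenges without gaps or overlaps; $\operatorname{M}(R)$ denotes the number of tilings of $R$. Vertical distances are measured in rows (the height of a unit triangle); ''the horizontal lattice line at level $t$ above a point $P$'' is the horizontal lattice line $t$ rows above $P$. Lattice hexagons have all angles $120^\circ$ and their side-lengths are listed clockwise starting from the horizontal top side: north, northeast, southeast, south, southwest, northwest. The east vertex is the common vertex of the northeast and southeast sides; the west vertex is the common vertex of the southwest and northwest sides. Hyperfactorial: $\operatorname{H}(n)=0!\,1!\cdots(n-1)!$ for nonnegative integers $n$ ($\operatorname{H}(0)=1$). For a sequence $\mathbf t=(t_1,\dots,t_r)$ of nonnegative integers, $o_t=\sum_{i\text{ odd}}t_i$, $e_t=\sum_{i \text{ even}}t_i$, and $t=t_1+\dots+t_r$; so $a,b,c,o_a,e_a,o_b,\dots$ refer to $\mathbf a,\mathbf b,\mathbf c$. Dented semihexagon: $s(t_1,\dots,t_r)$ is the number of tilings of the region obtained from the trapezoid with horizontal top side of length $e_t$, horizontal bottom side of length $o_t+e_t$, and two slanted sides of length $o_t$, by removing from its bottom side up-pointing triangles of side-lengths $t_1,t_3,t_5,\dots$ from left to right, the first starting at the left end of the bottom side and consecutive removed triangles separated along the bottom side by distances $t_2,t_4,\dots$. (Equivalently, $s(t_1,\dots,t_{2l-1})=s(t_1,\dots,t_{2l})=\frac{1}{\operatorname{H}(t_1+t_3+\dots+t_{2l-1})}\frac{\prod_{1\le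 i<j\le 2l-1,\ j-i\text{ odd}}\operatorname{H}(t_i+\dots+t_j)}{\prod_{1\le i<j\le 2l-1,\ j-i\text{ even}}\operatorname{H}(t_i+\dots+t_j)}$.) Cored hexagon: for nonnegative integers $X,Y,Z,p$, $C_{X,Y,Z}(p)$ is obtained from the hexagon $H$ with side-lengths $X,Y+p,Z,X+p,Y,Z+p$ as follows. Let $H_0$ be the hexagon with side-lengths $X,Y,Z,X,Y,Z$ whose south, southwest and northwest sides lie on the lines of the south, southwest and northwest sides of $H$; let $O$ be the center of symmetry of $H_0$. Remove the up-pointing triangle of side $p$ whose left vertex is: $O$ if $X,Y,Z$ all have the same parity; the point $1/2$ unit west of $O$ if $X$ has parity different from $Y$ and $Z$; the point $1/2$ unit from $O$ in the northwest lattice direction if $Y$ has parity different from $X$ and $Z$; the point $1/2$ unit from $O$ in the southwest lattice direction if $Z$ has parity different from $X$ and $Y$. Fern: a string of lattice triangles of side-lengths $t_1,\dots,t_r$ (side $0$ allowed) with alternating orientations, all having a horizontal side on a common horizontal lattice line $\ell$ (up-pointing ones above $\ell$, down-pointing ones below), consecutive triangles meeting at a vertex on $\ell$; it occupies a segment of $\ell$ of length $t_1+\dots+t_r$. Removing a fern means removing the union of its triangles. The region $R^{\swarrow}_{x,y,z}(\mathbf a;\mathbf c;\mathbf b)$ (for $x\not\equiv z \pmod 2$): let $H$ be the hexagon with side-lengths $x+o_a+e_b+e_c$, $2y+z+e_a+o_b+o_c+|a-b|+1$, $z+o_a+e_b+e_c$, $x+e_a+o_b+o_c$, $2y+z+o_a+e_b+e_c+|a-b|+1$,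 $z+e_a+o_b+o_c$. Let $\ell$ be the horizontal lattice line at level $y$ above the east vertex of $H$ if $a\le b$, and at level $y+a-b$ if $a>b$; $\ell\cap H$ is a segment of length $x+z+a+b+c$. Remove from $H$ three ferns along $\ell$: the left fern with side-lengths $a_1,\dots,a_m$ from left to right, $a_1$ down-pointing, starting at the left endpoint of $\ell\cap H$; the right fern with side-lengths $b_1,\dots,b_n$ read from right to left, $b_1$ up-pointing, ending at the right endpoint of $\ell\cap H$; and the middle fern with side-lengths $c_1,\dots,c_k$ from left to right, $c_1$ up-pointing, placed so that the distance along $\ell$ from the right end of the left fern to the left end of the middle fern is $\lfloor\frac{x+z}{2}\rfloor$ and the distance from the right end of the middle fern to the left end of the right fern is $\lceil\frac{x+z}{2}\rceil$. *)

(* Defs.v *)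
From mathcomp Require Import all_boot all_order all_algebra finmap.

Set Implicit Arguments.
Unset Strict Implicit.
Unset Printing Implicit Defensive.

Import Order.TTheory GRing.Theory Num.Theory.
Local Open Scope fset_scope.
Local Open Scope ring_scope.

(* The lattice point (u, v) is u * e1 + v * e2, where e1 is the unit vector
   pointing east and e2 the unit lattice vector pointing northeast.  Hence v is
   the row of the point, and v, u and u + v are constant on the three families
   of lattice lines (horizontal, parallel to e2, parallel to e1 - e2). *)
Definition point : Type := (int * int)%type.

(* ((u, v), true) and ((u, v), false) are the up-pointing and the down-pointing
   unit triangles of the unit rhombus spanned by e1, e2 at (u, v). *)
Definition cell : Type := (point * bool)%type.

Definition vertices (c : cell) : seq point :=
  let: ((u, v), up) := c in
  if up then [:: (u, v); (u + 1, v); (u, v + 1)]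
  else [:: (u + 1, v); (u, v + 1); (u + 1, v + 1)].

(* Two distinct unit triangles share an edge iff they have exactly two common
   vertices. *)
Definition share_edge (c d : cell) : bool :=
  size [seq p <- vertices c | p \in vertices d] == 2%N.

Definition lozenges (R : {fset cell}) : {fset {fset cell}} :=
  [fset [fset c; d] | c in R, d in R & share_edge c d].

Definition is_tiling (R : {fset cell}) (T : {fset {fset cell}}) : bool :=
  (fcover T == R) && trivIfset T.

(* M(R) *)
Definition tilings_nb (R : {fset cell}) : nat :=
  #|` [fset T in fpowerset (lozenges R) | is_tiling R T]|.

(* The cells contained in the convex lattice polygon
   u0 <= u <= u1, v0 <= v <= v1, w0 <= u + v <= w1. *)
Definition polygon (u0 u1 v0 v1 w0 w1 : int) : {fset cell} :=
  let inside (p : point) :=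
    [&& u0 <= p.1 <= u1, v0 <= p.2 <= v1 & w0 <= p.1 + p.2 <= w1] in
  let box := [seq (u0 + Posz i, v0 + Posz j)
             | i <- iota 0 (absz (u1 - u0)%R), j <- iota 0 (absz (v1 - v0)%R)] in
  [fset c in [seq (p, up) | p <- box, up <- [:: true; false]]
  | all inside (vertices c)].

(* The triangle of side p with leftmost vertex (i, j); its horizontal side is
   on the line v = j whether it points up or down. *)
Definition triangle (up : bool) (i j p : int) : {fset cell} :=
  if up then polygon i (i + p) j (j + p) (i + j) (i + j + p)
  else polygon i (i + p) (j - p) j (i + j) (i + j + p).

(* The fern on the line v = j whose left end is (i, j), with side-lengths t from
   left to right; up is the orientation of its leftmost triangle. *)
Fixpoint fern (up : bool) (i j : int) (t : seq nat) : {fset cell} :=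
  if t is p :: t' then
    triangle up i j (Posz p) `|` fern (~~ up) (i + Posz p) j t'
  else fset0.

(* The hexagon with west vertex (0, 0).  The other vertices are, clockwise,
   (0, nw), (n, nw), (n + ne, nw - ne), (sw + s, - sw) and (sw, - sw).  The
   hexagon closes up iff n + ne = s + sw and ne + se = sw + nw, so that two of
   the six side-lengths are redundant. *)
Definition hexagon (n ne se s sw nw : int) : {fset cell} :=
  polygon 0 (sw + s) (- sw) nw 0 (n + nw).

(* o_t and e_t; positions are numbered from 1 in o_t, e_t and from 0 in nth. *)
Definition osum (t : seq nat) : nat :=
  (\sum_(i < size t | ~~ odd i) nth 0 t i)%N.
Definition esum (t : seq nat) : nat :=
  (\sum_(i < size t | odd i) nth 0 t i)%N.

Definition hyperfact (n : nat) : nat := (\prod_(i < n) i`!)%N.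

(* The trapezoid has its bottom left vertex at (0, 0). *)
Definition dented_semihexagon (t : seq nat) : {fset cell} :=
  let l := (osum t)%:Z + (esum t)%:Z in
  polygon 0 l 0 (osum t)%:Z 0 l
  `\` \bigcup_(i <- iota 0 (size t) | ~~ odd i)
        triangle true (sumn (take i t))%:Z 0 (nth 0%N t i)%:Z.

(* s(t_1, ..., t_r) *)
Definition semihex_nb (t : seq nat) : nat := tilings_nb (dented_semihexagon t).

(* The left vertex of the core.  The hexagon H_0 has the same west vertex (0, 0)
   as H, and its east vertex is (X + Y, Z - Y), so 2 O = (X + Y, Z - Y).  West,
   northwest and southwest are the directions (-1, 0), (-1, 1) and (0, -1); both
   divisions by 2 are exact. *)
Definition core_vertex (X Y Z : nat) : point :=
  let shift : point :=
    if odd X == odd Y then if odd Y == odd Z then (0, 0) else (0, -1)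
    else if odd Y == odd Z then (-1, 0) else (-1, 1) in
  (((X%:Z + Y%:Z + shift.1) %/ 2)%Z, ((Z%:Z - Y%:Z + shift.2) %/ 2)%Z).

(* C_{X,Y,Z}(p) *)
Definition cored_hexagon (X Y Z p : nat) : {fset cell} :=
  let P := core_vertex X Y Z in
  hexagon X%:Z (Y%:Z + p%:Z) Z%:Z (X%:Z + p%:Z) Y%:Z (Z%:Z + p%:Z)
  `\` triangle true P.1 P.2 p%:Z.

(* R^{swarrow}_{x,y,z}(a; c; b).  On the line v = lev, the hexagon is bounded on
   the left by the lines u = 0 (northwest side) and u + v = 0 (southwest side),
   and on the right by u = n + ne (southeast side) and u + v = n + nw (northeast
   side).  From left to right the right fern is b_n, ..., b_1; as b_1 points up,
   b_n points up iff n is odd. *)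
Definition region_sw (x : nat) (y : int) (z : nat) (a c b : seq nat) :
    {fset cell} :=
  let A := (sumn a)%:Z in let B := (sumn b)%:Z in let C := (sumn c)%:Z in
  let oa := (osum a)%:Z in let ea := (esum a)%:Z in
  let ob := (osum b)%:Z in let eb := (esum b)%:Z in
  let oc := (osum c)%:Z in let ec := (esum c)%:Z in
  let n := x%:Z + oa + eb + ec in
  let ne := 2 * y + z%:Z + ea + ob + oc + `|A - B| + 1 in
  let se := z%:Z + oa + eb + ec in
  let s := x%:Z + ea + ob + oc in
  let sw := 2 * y + z%:Z + oa + eb + ec + `|A - B| + 1 in
  let nw := z%:Z + ea + ob + oc in
  let east_lev := nw - ne in
  let lev := east_lev + (if A <= B then y else y + A - B) in
  let left_end := Order.max 0 (- lev) in
  let right_end := Order.min (n + ne) (n + nw - lev) in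
  hexagon n ne se s sw nw
  `\` (fern false left_end lev a
       `|` fern true (left_end + A + ((x + z)./2)%:Z) lev c
       `|` fern (odd (size b)) (right_end - B) lev (rev b)).

(* Main.v *)
Require Import Defs.
From mathcomp Require Import all_boot all_order all_algebra finmap.
From mathcomp Require Import perm zify ring.
Set Implicit Arguments.
Unset Strict Implicit.
Unset Printing Implicit Defensive.
Import Order.TTheory GRing.Theory Num.Theory.
Local Open Scope fset_scope.
Local Open Scope ring_scope.

(** Cut the region along the line carrying the ferns.  A tiling is determined by
    the set S of the z free positions of that line crossed by a lozenge, together
    with tilings of the two halves.  Each half, completed to a trapezoid by a
    triangle at one end of the line, is a dented semihexagon, and a trapezoid with
    dents at X has (Vandermonde product of X) / H(#X) tilings: its rows are
    interlacing sequences, and summing determinants of binomial coefficients over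
    interlacing sequences gives again such a determinant.  If U and D are the dents
    of the two halves other than S, then
    V(U + S) V(D + S) = V(U) V(D) V(S)^2 prod_(i in U + D, s in S) |i - s|,
    and the set U + D depends on the ferns only through their total lengths.  The
    sum over S is therefore the same as for the cored hexagon, and it cancels from
    the quotient of the two numbers of tilings. *)

(** The line of the ferns runs [h] rows below the west vertex and [r] rows above the east vertex,
    where [h] = y+1+b-nu and [r] = y+a-nu; the bounds on y say exactly that both are nonnegative.
    The triangles completing the halves have sides [h] and [r] and these two vertices as apexes.
    With the adjacent outer fern, each blocks an end interval of the line, of length h+a = mu+y+1 on
    the left and r+b = mu+y on the right. In the cored hexagon with Y = 2y+z+2mu+1, the base of the
    core lies on a line with these very lengths in the roles of [h] and [r]; their difference of one
    matches the half-unit shift of the core when the parity of Z differs from that of X and Y. The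
    hyperfactorials arise as follows. A semihexagon has as many rows as dents, so the two values of
    s are V(U)/H(#U) and V(D)/H(#D), while the halves of the region have #U+z and #D+z rows. For the
    cored hexagon, U consists of two intervals and D of one; V of an interval and the product of
    distances between two intervals are quotients of hyperfactorials. *)

Definition adjacent (c d : cell) : bool :=
  let: ((u, v), b) := c in let: ((u', v'), b') := d in
  match b, b' with
  | true, false => [|| (u' == u) && (v' == v), (u' == u - 1) && (v' == v)
                     | (u' == u) && (v' == v - 1)]
  | false, true => [|| (u' == u) && (v' == v), (u' == u + 1) && (v' == v)
                     | (u' == u) && (v' == v + 1)]
  | _, _ => false
  end.

Lemma share_edgeE c d : share_edge c d = adjacent c d.
Proof.
case: c d => [[u v] b] [[u' v'] b'].
(* Only the differences of the coordinates matter; beyond distance one in either coordinate all the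
   tests fail, so finitely many cases remain. *)
have shift (s t : int) : t = s + (t - s) by lia.
rewrite (shift u u') (shift v v'); move: (u' - u) (v' - v) => i j {u' v' shift}.
have E0 (s k : int) : (s + k == s) = (k == 0) by lia.
have E1 (s k : int) : (s + k == s + 1) = (k == 1) by lia.
have E2 (s k : int) : (s + k == s - 1) = (k == -1) by lia.
have E3 (s k : int) : (s == s + k) = (k == 0) by lia.
have E4 (s k : int) : (s + 1 == s + k) = (k == 1) by lia.
have E5 (s k : int) : (s == s + k + 1) = (k == -1) by lia.
have E6 (s k : int) : (s + 1 == s + k + 1) = (k == 0) by lia.
rewrite /share_edge size_filter /vertices /adjacent.
case: b; case: b' => /=; rewrite !inE !xpair_eqE !(E0, E1, E2, E3, E4, E5, E6);
by case: i => [[|[|i]]|[|i]]; case: j => [[|[|j]]|[|j]].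
Qed.

Lemma in_polygon u0 u1 v0 v1 w0 w1 u v b :
  (((u, v), b) \in polygon u0 u1 v0 v1 w0 w1) =
  [&& u0 <= u, u + 1 <= u1, v0 <= v, v + 1 <= v1,
      w0 <= u + v + (~~ b)%:Z & u + v + 1 + (~~ b)%:Z <= w1].
Proof.
rewrite /polygon !inE /=; set Q := RHS.
set P := all _ _.
have -> : P = Q by rewrite /P /Q; case: b {P Q} => /=; lia.
rewrite andb_idl // /Q => HQ.
apply/flattenP; exists [:: ((u, v), true); ((u, v), false)]; last first.
  by case: (b); rewrite !inE eqxx ?orbT.
apply: (map_f (fun p => [:: (p, true); (p, false)])).
apply/allpairsP; exists (`|u - u0|%N, `|v - v0|%N); rewrite /= !mem_iota.
by split; [lia | lia | congr pair; lia].
Qed.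

Lemma share_edgeC c d : share_edge c d = share_edge d c.
Proof.
rewrite !share_edgeE; case: c d => [[u v] b] [[u' v'] b'] /=.
by case: b b' => [] [] //; lia.
Qed.

Lemma share_edge_irr c : share_edge c c = false.
Proof. by rewrite share_edgeE; case: c => [[u v] []]. Qed.

(** * Tilings as perfect matchings of cells *)

Lemma lozengesP (R : {fset cell}) (l : {fset cell}) :
  reflect (exists c d, [/\ c \in R, d \in R, share_edge c d & l = [fset c; d]])
          (l \in lozenges R).
Proof.
apply: (iffP idP) => [/imfset2P[c /= cR [d]]|[c [d [cR dR cd ->]]]].
  by rewrite !inE /= => /andP[dR cd] ->; exists c, d.
by apply/imfset2P; exists c => //=; exists d => //=; rewrite !inE /= dR cd.
Qed.

Definition tilings (R : {fset cell}) : {fset {fset {fset cell}}} :=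
  [fset T in fpowerset (lozenges R) | is_tiling R T].

Lemma tilingsP (R : {fset cell}) (T : {fset {fset cell}}) :
  reflect [/\ {in T, forall l, l \in lozenges R},
              {in R, forall c, exists2 l, l \in T & c \in l} &
              forall l l' c, l \in T -> l' \in T -> c \in l -> c \in l' -> l = l']
          (T \in tilings R).
Proof.
rewrite !inE /= fpowersetE /is_tiling.
apply: (iffP and3P) => [[/fsubsetP TR /eqP cov /trivIfsetP tri]|[TR cov tri]].
  split=> // [c|l l' c lT l'T cl cl'].
    by rewrite -cov => /bigfcupP[l]; rewrite andbT => lT cl; exists l.
  apply/eqP/negP => /negP ll'; have /fdisjointP/(_ c cl) := tri _ _ lT l'T ll'.
  by rewrite cl'.
split; first by apply/fsubsetP.
  rewrite eqEfsubset; apply/andP; split; apply/fsubsetP => c.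
    case/bigfcupP => l; rewrite andbT => /TR/lozengesP[d [e [dR eR _ ->]]].
    by rewrite !inE => /orP[] /eqP ->.
  by move=> /cov[l lT cl]; apply/bigfcupP; exists l => //; rewrite lT.
apply/trivIfsetP => l l' lT l'T; apply: contraNT.
rewrite -fsetI_eq0 => /fset0Pn[c]; rewrite inE => /andP[cl cl'].
by apply/eqP/(tri l l' c).
Qed.

Lemma mem_tiling_extend (R : {fset cell}) c d T :
    c \in R -> d \in R -> share_edge c d ->
  T \in tilings (R `\` [fset c; d]) ->
  [fset c; d] |` T \in tilings R.
Proof.
move=> cR dR cd /tilingsP[TR cov tri].
have TR' l e : l \in T -> e \in l -> e \notin [fset c; d].
  move=> /TR/lozengesP[c' [d' []]]; rewrite !inE => /andP[? _] /andP[? _] _ -> /=.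
  by rewrite !inE => /orP[] /eqP ->.
apply/tilingsP; split=> [l|e eR|l l' e].
- rewrite !inE => /orP[/eqP ->|/TR/lozengesP[c' [d' []]]].
    by apply/lozengesP; exists c, d.
  rewrite !inE => /andP[_ ?] /andP[_ ?] ? ->.
  by apply/lozengesP; exists c', d'.
- have [ecd|ecd] := boolP (e \in [fset c; d]).
    by exists [fset c; d] => //; rewrite !inE eqxx.
  have [|l lT el] := cov e; first by rewrite inE ecd.
  by exists l => //; rewrite !inE lT orbT.
- rewrite inE in_fset1 => /orP[/eqP->|lT]; rewrite inE in_fset1 => /orP[/eqP->|l'T] // el el'.
  + by have := TR' _ _ l'T el'; rewrite el.
  + by have := TR' _ _ lT el; rewrite el'.
  exact: (tri _ _ e).
Qed.

Lemma mem_tiling_restrict (R : {fset cell}) c d T :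
  T \in tilings R -> [fset c; d] \in T ->
  T `\ [fset c; d] \in tilings (R `\` [fset c; d]).
Proof.
move=> /tilingsP[TR cov tri] cdT.
apply/tilingsP; split=> [l|e|l l' e].
- rewrite in_fsetD1 => /andP[ncd lT]; case/lozengesP: (TR _ lT) => c' [d' [c'R d'R c'd' E]].
  have out e : e \in l -> e \notin [fset c; d].
    move=> el; apply: contra ncd => ecd; apply/eqP.
    exact: (tri _ _ e).
  apply/lozengesP; exists c', d'; split=> //; rewrite inE ?c'R ?d'R andbT;
    by apply: out; rewrite E !inE eqxx ?orbT.
- rewrite inE => /andP[ne eR]; have [l lT el] := cov _ eR.
  exists l => //; rewrite in_fsetD1 lT andbT; apply: contra ne => /eqP <- //.
- rewrite !in_fsetD1 => /andP[_ lT] /andP[_ l'T]; exact: tri.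
Qed.

Lemma tilings_nb0 : tilings_nb fset0 = 1%N.
Proof.
rewrite -[tilings_nb _]/(#|` tilings fset0|).
suff -> : tilings fset0 = [fset fset0] by rewrite cardfs1.
apply/fsetP => T; rewrite in_fset1; apply/tilingsP/eqP => [[TR _ _]|->].
  apply/fsetP => l; rewrite in_fset0; apply/negP => /TR/lozengesP[c [d []]].
  by rewrite in_fset0.
by split=> [l|c|l l' c]; rewrite ?in_fset0.
Qed.

(** Each tiling contains exactly one lozenge covering [c], so counting the pairs of a tiling and a
    lozenge at [c] in two ways sorts the tilings by the partner of [c]. The later counts reach
    [tilings_nb] through this recursion. *)
Lemma tilings_nb_rec (R : {fset cell}) c : c \in R ->
  tilings_nb R =
  (\sum_(d <- R | share_edge c d) tilings_nb (R `\` [fset c; d]))%N.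
Proof.
move=> cR; rewrite -[tilings_nb R]/(#|` tilings R|) -sum1_size /=.
rewrite (eq_big_seq (fun T : {fset {fset cell}} =>
   (\sum_(d <- R | share_edge c d) ([fset c; d] \in T)))%N); last first.
  move=> T /tilingsP[TR cov tri]; have [l lT cl] := cov _ cR.
  have [d [dR cd E]] : exists d, [/\ d \in R, share_edge c d & l = [fset c; d]].
    have /lozengesP[c' [d [c'R dR c'd E]]] := TR _ lT.
    move: cl; rewrite E !inE => /orP[] /eqP E'; subst c; first by exists d.
    by exists c'; rewrite share_edgeC fsetUC.
  rewrite big_mkcond (bigD1_seq d) //= cd -E lT big1 ?addn0 // => e ed.
  case: ifP => // ce; case: (boolP (_ \in T)) => // ceT.
  have : [fset c; e] = [fset c; d] by rewrite -E; apply: (tri _ _ c); rewrite ?cl // !inE eqxx.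
  move=> /fsetP/(_ e); rewrite !inE eqxx orbT (negPf ed) orbF => /esym/eqP ec.
  by rewrite ec share_edge_irr in ce.
rewrite exchange_big /= big_seq_cond [RHS]big_seq_cond.
apply: eq_bigr => d /andP[dR cd].
transitivity (count (fun T : {fset {fset cell}} => [fset c; d] \in T) (tilings R)).
  by rewrite -sum1_count [RHS]big_mkcond /=; apply: eq_bigr => T _; case: (_ \in T).
rewrite -size_filter -[RHS]/(#|` tilings (R `\` [fset c; d])|).
rewrite -[RHS](size_map (fun T => [fset c; d] |` T)); apply: perm_size.
have notin T : T \in tilings (R `\` [fset c; d]) -> [fset c; d] \notin T.
  move=> /tilingsP[TR _ _]; apply/negP => /TR/lozengesP[c' [d' []]].
  move=> c'R _ _ /fsetP/(_ c'); move: c'R; rewrite !inE eqxx orTb.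
  by move=> /andP[/negPf -> _].
apply: uniq_perm.
- exact/filter_uniq/fset_uniq.
- rewrite map_inj_in_uniq ?fset_uniq // => T T' TR T'R /(congr1 (fun X => X `\ [fset c; d])).
  by rewrite !fsetU1K ?notin.
move=> T; rewrite mem_filter; apply/andP/mapP => [[cdT TR]|[T' T'R ->]].
  exists (T `\ [fset c; d]); last by rewrite fsetD1K.
  exact: mem_tiling_restrict.
by rewrite fset1U1; split=> //; apply: mem_tiling_extend.
Qed.

Local Opaque tilings_nb share_edge.

Lemma tilings_nb_forced (R : {fset cell}) c d :
    c \in R -> d \in R -> share_edge c d ->
    {in R, forall e, share_edge c e -> e = d} ->
  tilings_nb R = tilings_nb (R `\` [fset c; d]).
Proof.
move=> cR dR cd uni; rewrite (tilings_nb_rec cR) big_mkcond (bigD1_seq d) //= cd.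
rewrite big_seq_cond big1 ?addn0 // => e /andP[eR ed]; case: ifP => // ce.
by rewrite (uni e) ?eqxx in ed.
Qed.

Lemma tilings_nb_isolated (R : {fset cell}) c :
  c \in R -> {in R, forall e, ~~ share_edge c e} -> tilings_nb R = 0%N.
Proof.
move=> cR iso; rewrite (tilings_nb_rec cR) big_seq_cond big1 // => e /andP[eR].
by rewrite (negPf (iso e eR)).
Qed.

Lemma sum_fset_two (K : choiceType) (R : {fset K}) (p : pred K) (F : K -> nat) d e :
    d != e -> p d -> p e -> {in R, forall f, p f -> f \in [:: d; e]} ->
  (\sum_(f <- R | p f) F f = (d \in R) * F d + (e \in R) * F e)%N.
Proof.
move=> de pd pe uni; rewrite -big_filter.
rewrite (perm_big [seq f <- [:: d; e] | f \in R]); last first.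
  apply: uniq_perm => [||f]; first exact/filter_uniq/fset_uniq.
    by rewrite filter_uniq //= inE de.
  rewrite !mem_filter !inE; apply/andP/andP => [[pf fR]|[fR fde]]; split=> //.
    by have := uni _ fR pf; rewrite !inE.
  by case/orP: fde => /eqP ->.
rewrite big_filter !big_cons big_nil.
by case: (d \in R); case: (e \in R); rewrite /= ?mul1n ?mul0n ?addn0 ?add0n.
Qed.

Lemma tilings_nb_branch (R : {fset cell}) c d e :
    c \in R -> d != e -> share_edge c d -> share_edge c e ->
    {in R, forall f, share_edge c f -> f \in [:: d; e]} ->
  tilings_nb R = ((d \in R) * tilings_nb (R `\` [fset c; d])
                  + (e \in R) * tilings_nb (R `\` [fset c; e]))%N.
Proof.
move=> cR de cd ce uni; rewrite (tilings_nb_rec cR).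
exact: (@sum_fset_two _ R (share_edge c) (fun d => tilings_nb (R `\` [fset c; d]))).
Qed.

Lemma tilings_nb_inj (f : cell -> cell) (R : {fset cell}) :
    injective f -> (forall c d, share_edge (f c) (f d) = share_edge c d) ->
  tilings_nb (f @` R) = tilings_nb R.
Proof.
move=> finj fE; have [n] := ubnP #|` R|; elim: n R => // n IH R.
have [->|[c cR]] := fset_0Vmem R; first by rewrite imfset0.
rewrite ltnS => sR; rewrite (tilings_nb_rec cR) (tilings_nb_rec (in_imfset _ f cR)) /=.
rewrite [LHS]big_mkcond big_imfset /=; last by move=> d e _ _ /finj.
rewrite [RHS]big_mkcond; apply: eq_big_seq => d dR; rewrite fE.
case: (share_edge c d); last by [].
rewrite -(IH (R `\` [fset c; d])); last first.
  apply: leq_trans sR; apply: fproper_ltn_card; rewrite fproperE fsubsetDl /=.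
  by apply/fsubsetPn; exists c => //; rewrite !inE eqxx.
congr tilings_nb; apply/fsetP => e; rewrite !inE.
apply/andP/imfsetP => [[nE /imfsetP[e' /= e'R Ee]]|[e']].
  exists e' => //=; rewrite !inE e'R andbT; move: nE; rewrite Ee.
  by rewrite !(inj_eq finj).
rewrite /= !inE => /andP[ne' e'R] ->; rewrite !(inj_eq finj); split=> //.
exact: in_imfset.
Qed.

Lemma ltn_card_fsetD2 (R : {fset cell}) c d :
  c \in R -> (#|` R `\` [fset c; d]| < #|` R|)%N.
Proof.
move=> cR; apply: fproper_ltn_card; rewrite fproperE fsubsetDl /=.
by apply/fsubsetPn; exists c => //; rewrite !inE eqxx.
Qed.

(** [p i] and [q i] are the two cells at the [i]-th edge of the cut, and [S] is the set of edges
    covered by lozenges. The induction removes a cell [c] of [P] together with its partner. *)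
Lemma tilings_nb_cut (I : finType) (p q : I -> cell) (P Q : {fset cell}) :
    injective p -> injective q -> [disjoint P & Q] ->
    (forall i, share_edge (p i) (q i)) ->
    (forall c d, c \in P -> d \in Q -> share_edge c d ->
       exists2 i, c = p i & d = q i) ->
  tilings_nb (P `|` Q) =
  (\sum_(S : {set I} | [forall i in S, (p i \in P) && (q i \in Q)])
     tilings_nb (P `\` [fset p i | i in S]) *
     tilings_nb (Q `\` [fset q i | i in S]))%N.
Proof.
move=> pinj qinj; have [n] := ubnP #|` P|; elim: n P Q => // n IH P Q.
rewrite ltnS => sP dPQ pq cross.
have pS (S : {set I}) j : (p j \in [fset p i | i in S]) = (j \in S).
  by rewrite mem_imfset.
have qS (S : {set I}) j : (q j \in [fset q i | i in S]) = (j \in S).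
  by rewrite mem_imfset.
have [P0|[c cP]] := fset_0Vmem P.
  rewrite P0 fset0U (big_pred1 set0) => [|S].
    have -> : [fset q i | i in (set0 : {set I})] = fset0.
      by apply/fsetP => d; rewrite inE; apply/imfsetP => -[i]; rewrite /= inE.
    by rewrite fset0D fsetD0 tilings_nb0 mul1n.
  apply/forall_inP/eqP => [H|->] => [|i]; last by rewrite inE.
  by apply/setP => i; rewrite inE; apply/negP => /H; rewrite inE.
have cQ : c \notin Q by move/fdisjointP: dPQ; apply.
have cPQ : c \in P `|` Q by rewrite inE cP.
rewrite (tilings_nb_rec cPQ) (perm_big (P ++ Q)); last first.
  apply: uniq_perm; rewrite ?cat_uniq ?fset_uniq ?andbT //=.
    by apply/hasPn => d dQ; apply/negP => dP; move/fdisjointP/(_ d dP): dPQ; rewrite dQ.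
  by move=> d; rewrite mem_cat !inE.
(* Sort the left side by whether the partner of [c] is in [Q] or in [P], and the right side by
   whether [c] is some [p i] with [i] in [S]. *)
rewrite big_cat /= [RHS](bigID (fun S : {set I} => c \in [fset p i | i in S])) /= addnC; congr addn.
  have [[i /andP[/eqP ci qiQ]]|none] := altP (@existsP I (fun i => (c == p i) && (q i \in Q))).
    subst c; rewrite [LHS]big_mkcond (bigD1_seq (q i)) ?fset_uniq //=.
    rewrite pq big_seq_cond big1 ?addn0; last first.
      move=> d /andP[dQ dq]; case: ifP => // pd.
      have [j /pinj ij dj] := cross _ d cP dQ pd.
      by rewrite dj ij eqxx in dq.
    have -> : (P `|` Q) `\` [fset p i; q i] = (P `\ p i) `|` (Q `\ q i).
      apply/fsetP => e; rewrite !inE negb_or; have [->|ep] := eqVneq e (p i).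
        by rewrite (negPf cQ) andbF.
      have [->|eq] := eqVneq e (q i); last by [].
      rewrite /= orbF; apply/esym/negP => qP.
      by move/fdisjointP/(_ _ qP): dPQ; rewrite qiQ.
    rewrite IH; first last.
    - by move=> e f; rewrite !inE => /andP[_ eP] /andP[_ fQ]; apply: cross.
    - by [].
    - by apply: fdisjointWl (fsubD1set _ _) _; apply: fdisjointWr (fsubD1set _ _) _.
    - by apply: leq_trans sP; rewrite (cardfsD1 (p i) P) cP.
    (* The crossed edges are [i] and the crossed edges of the region without [p i] and [q i]. *)
    rewrite [RHS](reindex_onto (fun S => i |: S) (fun S => S :\ i)) /=; last first.
      by move=> S; rewrite pS => /andP[_ iS]; rewrite setD1K.
    apply: eq_big => [S|S].
      rewrite pS setU11 andbT.
      apply/forall_inP/andP => [H|[/forall_inP H /eqP E] j jS].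
        have iS : i \notin S by apply/negP => /H; rewrite !inE eqxx.
        split; last by rewrite setU1K.
        apply/forall_inP => j; rewrite !inE => /orP[/eqP->|/H].
          by rewrite cP.
        by rewrite !inE => /andP[/andP[_ ->] /andP[_ ->]].
      have ij : j != i by move: jS; rewrite -E !inE => /andP[].
      have := H j; rewrite !inE jS orbT => /(_ isT) /andP[-> ->].
      by rewrite !(inj_eq pinj) !(inj_eq qinj) ij.
    move=> _; congr (tilings_nb _ * tilings_nb _)%N; apply/fsetP => e; rewrite !inE.
      have -> : (e \in [fset p j | j in i |: S]) = (e == p i) || (e \in [fset p j | j in S]).
        apply/imfsetP/orP => [[j]|[/eqP ->|/imfsetP[j /= jS ->]]].
        - rewrite /= !inE => /orP[/eqP -> ->|jS ->]; rewrite ?eqxx; [by left|right].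
          by rewrite pS.
        - by exists i => //=; rewrite setU11.
        by exists j => //=; rewrite !inE jS orbT.
      by rewrite negb_or andbA [X in X && _]andbC.
    have -> : (e \in [fset q j | j in i |: S]) = (e == q i) || (e \in [fset q j | j in S]).
      apply/imfsetP/orP => [[j]|[/eqP ->|/imfsetP[j /= jS ->]]].
      - rewrite /= !inE => /orP[/eqP -> ->|jS ->]; rewrite ?eqxx; [by left|right].
        by rewrite qS.
      - by exists i => //=; rewrite setU11.
      by exists j => //=; rewrite !inE jS orbT.
    by rewrite negb_or andbA [X in X && _]andbC.
  rewrite big_seq_cond big1 => [|d /andP[dQ cd]]; last first.
    have [i ci di] := cross c d cP dQ cd.
    by case/existsP: none; exists i; rewrite ci eqxx -di.
  rewrite big1 // => S /andP[/forall_inP H /imfsetP[i /= iS ci]].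
  by case/existsP: none; exists i; rewrite ci eqxx; have /andP[_ ->] := H i iS.
(* When the partner [d] is in [P], neither [c] nor [d] is matched across the cut, so [S] avoids
   both; this double sum is reached from either side, up to the order of summation. *)
transitivity (\sum_(d <- P | share_edge c d) \sum_(S : {set I} | 
     [&& [forall i in S, (p i \in P) && (q i \in Q)], c \notin [fset p i | i in S]
       & d \notin [fset p i | i in S]])
   tilings_nb ((P `\` [fset p i | i in S]) `\` [fset c; d]) *
     tilings_nb (Q `\` [fset q i | i in S]))%N.
  rewrite big_seq_cond [RHS]big_seq_cond; apply: eq_bigr => d /andP[dP cd].
  have dQ : d \notin Q by move/fdisjointP: dPQ; apply.
  have -> : (P `|` Q) `\` [fset c; d] = (P `\` [fset c; d]) `|` Q.
    apply/fsetP => e; rewrite !inE; have [->|] := eqVneq e c; first by rewrite (negPf cQ).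
    by have [->|] := eqVneq e d; rewrite ?(negPf dQ).
  rewrite IH; first last.
  - by move=> e f; rewrite !inE => /andP[_ eP] fQ; apply: cross.
  - by [].
  - exact: fdisjointWl (fsubsetDl _ _) _.
  - by apply: leq_trans sP; apply: ltn_card_fsetD2.
  apply: eq_big => S.
    apply/forall_inP/and3P => [H|[/forall_inP H cS dS] i iS].
      split.
      - by apply/forall_inP => i /H; rewrite !inE => /andP[/andP[_ ->] ->].
      - by apply/imfsetP => -[i /= /H]; rewrite !inE => + E; rewrite E eqxx.
      by apply/imfsetP => -[i /= /H]; rewrite !inE => + E; rewrite E eqxx orbT.
    have /andP[pP qQ] := H i iS; rewrite !inE pP qQ !andbT negb_or.
    by apply/andP; split; [apply: contra cS|apply: contra dS] => /eqP <-; rewrite pS.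
  by move=> _; congr (tilings_nb _ * _)%N; rewrite !fsetDDl fsetUC.
under [RHS]eq_bigr => S /andP[_ cS].
  have cPS : c \in P `\` [fset p i | i in S] by rewrite inE cS.
  rewrite (tilings_nb_rec cPS) big_distrl /=.
  rewrite (_ : \sum_(d <- _ | _) _ = \sum_(d <- P | share_edge c d && (d \notin [fset p i | i in S]))
      tilings_nb ((P `\` [fset p i | i in S]) `\` [fset c; d]) *
     tilings_nb (Q `\` [fset q i | i in S]))%N; last first.
    rewrite -big_filter -[RHS]big_filter; apply: perm_big; apply: uniq_perm.
    - exact/filter_uniq/fset_uniq.
    - exact/filter_uniq/fset_uniq.
    by move=> d; rewrite !mem_filter !inE andbA.
  over.
rewrite (exchange_big_dep (fun d => share_edge c d)) /=; last by move=> S d _ /andP[].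
apply: eq_bigr => d cd; apply: eq_bigl => S; rewrite cd /=.
by rewrite -andbA.
Qed.

(** * Determinants and interlacing sequences *)

(** The intervals are half-open because of the skewed coordinates: in a row, the down cells between
    the up cells at x and x' have abscissas x, ..., x'-1, and each has the up cell of the same
    abscissa above it. *)
Fixpoint interlacings (x : nat) (xs : seq nat) : seq (seq nat) :=
  if xs is x' :: xs' then
    [seq y :: ys | y <- index_iota x x', ys <- interlacings x' xs']
  else [:: [::]].

Lemma sum_interlacings_prod (R : comNzRingType) (F : nat -> nat -> R) x xs :
  \sum_(ys <- interlacings x xs) \prod_(i < size xs) F i (nth 0%N ys i)
  = \prod_(i < size xs) \sum_(nth 0%N (x :: xs) i <= y < nth 0%N xs i) F i y.
Proof.
elim: xs x F => [|x' xs IH] x F /=; first by rewrite big_seq1 !big_ord0.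
rewrite big_ord_recl /= -(IH x' (fun i => F i.+1)) big_allpairs_dep /=.
rewrite big_distrl /=; apply: eq_bigr => y _; rewrite big_distrr /=.
by apply: eq_bigr => ys _; rewrite big_ord_recl.
Qed.

Definition binom_det (n : nat) (xs : seq nat) : rat :=
  \det (\matrix_(i < n, j < n) ('C(nth 0%N xs i, j))%:R).

(** Subtracting from each row the preceding one keeps the determinant and turns the column of the
    C(x_i, 0) = 1 into the first unit vector. Expanding along it leaves the entries C(x_(i+1), j+1)
    - C(x_i, j+1), which by Pascal's rule are the sums of C(y, j) over x_i <= y < x_(i+1);
    multilinearity in the rows pulls these sums out. *)
Lemma binom_det_interlacings x xs : sorted leq (x :: xs) ->
  binom_det (size xs).+1 (x :: xs)
  = \sum_(ys <- interlacings x xs) binom_det (size xs) ys.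
Proof.
move=> xs_sorted; set n := size xs.
pose A : 'M[rat]_n.+1 := \matrix_(i, j) ('C(nth 0%N (x :: xs) i, j))%:R.
pose B : 'M[rat]_n.+1 := \matrix_(i, j)
  if (i : nat) is k.+1 then A i j - ('C(nth 0%N (x :: xs) k, j))%:R else A i j.
pose T : 'M[rat]_n.+1 := \matrix_(i, k) (k <= i)%N%:R.
have detT : \det T = 1.
  rewrite det_trig; first by rewrite big1 // => i _; rewrite mxE leqnn.
  by apply/is_trig_mxP => i j ij; rewrite mxE leqNgt ij.
have AE : A = T *m B.
  apply/matrixP => i j; rewrite [RHS]mxE.
  pose f k : rat := ('C(nth 0%N (x :: xs) k, j))%:R.
  have -> : A i j = \sum_(0 <= k < i.+1) (if k is l.+1 then f k - f l else f k).
    rewrite big_nat_recl //= telescope_sumr //.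
    by rewrite mxE addrC subrK.
  rewrite (big_nat_widen _ _ n.+1) ?ltn_ord // big_mkord big_mkcond /=.
  apply: eq_bigr => k _; rewrite /T /B !mxE ltnS.
  by case: (k <= i)%N; rewrite ?mul1r ?mul0r //; case: (k : nat).
rewrite /binom_det -/A AE det_mulmx detT mul1r (expand_det_col _ ord0).
rewrite big_ord_recl big1 ?addr0; last first.
  by move=> i _; rewrite /B !mxE /= !bin0 subrr mul0r.
rewrite /cofactor /= addn0 expr0 mul1r /B !mxE /= bin0 mul1r.
rewrite [LHS](congr1 _ (_ : _ = \matrix_(i < n, j < n)
   \sum_(nth 0%N (x :: xs) i <= y < nth 0%N xs i) ('C(y, j))%:R)); last first.
  apply/matrixP => i j; rewrite !mxE /=.
  rewrite (eq_bigr (fun y => ('C(y.+1, j.+1))%:R - ('C(y, j.+1))%:R)) => [|y _]; last first.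
    by rewrite binS natrD addrC addKr.
  rewrite telescope_sumr //; have /(sortedP 0%N)/(_ i) := xs_sorted; apply.
  by rewrite /= ltnS.
rewrite /determinant exchange_big /=; apply: eq_bigr => s _.
rewrite -big_distrr /=; congr (_ * _).
(* [sum_interlacings_prod] wants factors indexed by [nat], whereas [s] acts on ordinals; the default
   value is never reached, since k < n. *)
pose F k y : rat := (if (insub k : option 'I_n) is Some i then 'C(y, s i) else 0%N)%:R.
transitivity (\prod_(i < n) \sum_(nth 0%N (x :: xs) i <= y < nth 0%N xs i) F i y).
  apply: eq_bigr => i _; rewrite mxE; apply: eq_bigr => y _.
  by rewrite /F valK.
rewrite -sum_interlacings_prod; apply: eq_bigr => ys _; apply: eq_bigr => i _.
by rewrite mxE /F valK.
Qed.

(** The condition compares values rather than indices, so the product does not depend on the order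
    of the list and stays in [nat]. *)
Definition vdm (xs : seq nat) : nat :=
  (\prod_(i <- xs) \prod_(j <- xs | i < j) (j - i))%N.

(** The polynomials X(X-1)...(X-j+1) = j! C(X, j) are monic of degree j, so a unitriangular matrix
    ([C] below) expresses them through the powers of X; scaling the j-th column of the binomial
    matrix by j! thus gives the Vandermonde determinant. *)
Lemma binom_det_vdm xs : sorted ltn xs ->
  binom_det (size xs) xs * (hyperfact (size xs))%:R = (vdm xs)%:R.
Proof.
move=> xs_sorted; set n := size xs.
pose a : 'rV[rat]_n := \row_i (nth 0%N xs i)%:R.
pose P (j : nat) : {poly rat} := \prod_(0 <= k < j) ('X - (k%:R)%:P).
pose C : 'M[rat]_n := \matrix_(j, k) (P j)`_k.
have sizeP j : size (P j) = j.+1.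
  by rewrite size_prod_XsubC size_iota subn0.
have PE j x : (P j).[x%:R] = ('C(x, j) * j`!)%N%:R.
  rewrite bin_ffact /P horner_prod ffact_prod big_mkord.
  have [xj|jx] := ltnP x j.
    rewrite (bigD1 (Ordinal xj)) //= !hornerE subrr mul0r.
    by rewrite (bigD1 (Ordinal xj)) //= subnn mul0n.
  rewrite natr_prod; apply: eq_bigr => k _; rewrite !hornerE natrB //.
  exact: leq_trans (ltnW (ltn_ord k)) jx.
have detC : \det C = 1.
  rewrite det_trig; last first.
    by apply/is_trig_mxP => j k jk; rewrite mxE nth_default // sizeP.
  rewrite big1 // => j _; rewrite mxE.
  by have /monicP := monic_prod_XsubC (index_iota 0 j) xpredT (fun k => k%:R : rat);
     rewrite /lead_coef -/(P j) sizeP.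
pose d : 'rV[rat]_n := \row_j (j`!)%:R.
have E : diag_mx d *m (\matrix_(i < n, j < n) ('C(nth 0%N xs i, j))%:R)^T
         = C *m Vandermonde n a.
  apply/matrixP => j i; rewrite mul_diag_mx !mxE mulrC -natrM -PE.
  rewrite (horner_coef_wide _ (_ : _ <= n)%N) ?sizeP //.
  by apply: eq_bigr => k _; rewrite !mxE.
move/(congr1 determinant): E; rewrite !det_mulmx det_tr det_diag detC mul1r.
rewrite det_Vandermonde => E.
rewrite mulrC; transitivity (\prod_(j < n) d 0 j * binom_det n xs).
  by congr (_ * _); rewrite natr_prod; apply: eq_bigr => j _; rewrite mxE.
rewrite E /vdm (big_nth 0%N) big_mkord natr_prod; apply: eq_bigr => i _.
rewrite (big_nth 0%N) big_mkord natr_prod.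
have ltE (j : 'I_n) : (nth 0%N xs i < nth 0%N xs j)%N = (i < j)%N.
  have := sorted_ltn_nth ltn_trans 0%N xs_sorted.
  case: (ltngtP i j) => [ij|ji|ij] mono; first by apply: mono; rewrite ?inE ?ltn_ord.
    by apply/negbTE; rewrite -leqNgt ltnW //; apply: mono; rewrite ?inE ?ltn_ord.
  by rewrite ij ltnn.
apply: eq_big => [j|j ij]; first by rewrite ltE.
by rewrite !mxE natrB // ltnW // ltE.
Qed.

(** * Dented trapezoids *)

Lemma down_neighbours u v e : share_edge ((u, v), false) e ->
  e \in [:: ((u, v), true); ((u + 1, v), true); ((u, v + 1), true)].
Proof.
by rewrite share_edgeE; case: e => [[u' v'] []] //=; rewrite !inE !xpair_eqE !andbT.
Qed.

Lemma up_neighbours u v e : share_edge ((u, v), true) e ->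
  e \in [:: ((u, v), false); ((u - 1, v), false); ((u, v - 1), false)].
Proof.
by rewrite share_edgeE; case: e => [[u' v'] []] //=; rewrite !inE !xpair_eqE !andbT.
Qed.

Lemma in_fset_sub (R : {fset cell}) (p : pred cell) c :
  (c \in [fset c in R | p c]) = (c \in R) && p c.
Proof. by rewrite !inE. Qed.

Lemma in_fsetD2 (R : {fset cell}) (c d e : cell) :
  (e \in R `\` [fset c; d]) = [&& e != c, e != d & e \in R].
Proof. by rewrite in_fsetD in_fset2 negb_or andbA. Qed.

(** The first up cell has no neighbour to its left or below, so it is matched to its right, which
    puts the next up cell in the same situation. *)
Lemma forced_left (R : {fset cell}) (m : int) (k : nat) :
    (forall i, m <= i < m + k%:Z -> ((i, 0), true) \in R /\ ((i, 0), false) \in R) ->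
    ((m - 1, 0), false) \notin R -> (forall u, ((u, -1), false) \notin R) ->
  tilings_nb R = tilings_nb [fset c in R | ~~ ((c.1.2 == 0) && (m <= c.1.1 < m + k%:Z))].
Proof.
elim: k m R => [|k IH] m R inR mR bR.
  congr tilings_nb; apply/fsetP => -[[u v] b]; rewrite in_fset_sub /=.
  by rewrite (_ : _ && (_ <= _ < _) = false) ?andbT //; lia.
have [UR DR] : ((m, 0), true) \in R /\ ((m, 0), false) \in R by apply: inR; lia.
rewrite (tilings_nb_forced UR DR); first last.
- move=> e eR /up_neighbours; rewrite !inE => /or3P[] /eqP E //.
    by rewrite E (negPf mR) in eR.
  by rewrite E sub0r (negPf (bR _)) in eR.
- by rewrite share_edgeE /= !eqxx.
rewrite (IH (m + 1)).
- congr tilings_nb; apply/fsetP => -[[u v] b].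
  rewrite !in_fset_sub in_fsetD2 !xpair_eqE /=.
  by case: (_ \in R); rewrite ?andbT ?andbF //; case: b => /=; lia.
- move=> i Hi; rewrite !in_fsetD2 !xpair_eqE /= !andbF !andbT.
  have [-> ->] := inR i ltac:(lia); split; lia.
- by rewrite in_fsetD2 addrK DR !xpair_eqE /= !eqxx andbF.
- by move=> u; rewrite in_fsetD2 (negPf (bR u)) !andbF.
Qed.

Lemma forced_right (R : {fset cell}) (m : int) (k : nat) :
    (forall i, m <= i < m + k%:Z -> ((i + 1, 0), true) \in R /\ ((i, 0), false) \in R) ->
    ((m + k%:Z, 0), false) \notin R -> (forall u, ((u, -1), false) \notin R) ->
  tilings_nb R = tilings_nb [fset c in R | ~~ ((c.1.2 == 0) &&
                    (m + (c.2)%:Z <= c.1.1 < m + k%:Z + (c.2)%:Z))].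
Proof.
elim: k R => [|k IH] R inR mR bR.
  congr tilings_nb; apply/fsetP => -[[u v] b]; rewrite in_fset_sub /=.
  by rewrite (_ : _ && (_ <= _ < _) = false) ?andbT //; lia.
have [UR DR] : ((m + k%:Z + 1, 0), true) \in R /\ ((m + k%:Z, 0), false) \in R.
  by apply: inR; lia.
rewrite (tilings_nb_forced UR DR); first last.
- move=> e eR /up_neighbours; rewrite !inE => /or3P[] /eqP E.
  + move: eR; rewrite E (_ : m + k%:Z + 1 = m + k.+1%:Z) ?(negPf mR) //; lia.
  + by rewrite E addrK.
  by rewrite E sub0r (negPf (bR _)) in eR.
- by rewrite share_edgeE /= addrK !eqxx orbT.
rewrite IH.
- congr tilings_nb; apply/fsetP => -[[u v] b].
  rewrite !in_fset_sub in_fsetD2 !xpair_eqE /=.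
  by case: (_ \in R); rewrite ?andbT ?andbF //; case: b => /=; lia.
- move=> i Hi; rewrite !in_fsetD2 !xpair_eqE /= !andbF !andbT.
  have [-> ->] := inR i ltac:(lia); split; lia.
- by rewrite in_fsetD2 DR !xpair_eqE /= !eqxx andbF.
- by move=> u; rewrite in_fsetD2 (negPf (bR u)) !andbF.
Qed.

(* Between consecutive dents [x < x'] of row 0 there is one more down-pointing than
   up-pointing cell, so exactly one lozenge crosses to the next row. *)
Lemma strip_segment (R : {fset cell}) (x x' : nat) : (x < x')%N ->
    (forall i : nat, (x < i < x')%N -> ((i%:Z, 0), true) \in R) ->
    (forall i : nat, (x <= i < x')%N -> ((i%:Z, 0), false) \in R) ->
    ((x%:Z, 0), true) \notin R -> ((x'%:Z, 0), true) \notin R ->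
    (forall u, ((u, -1), false) \notin R) ->
  tilings_nb R = (\sum_(x <= y < x') (((y%:Z, 1%R), true) \in R) *
    tilings_nb [fset c in R | ~~ ((c.1.2 == 0%R) && (x%:Z <= c.1.1 < x'%:Z)%R)
                              && (c != ((y%:Z, 1%R), true))])%N.
Proof.
move=> xx'; have [k E] : exists k, x' = (x + k.+1)%N.
  by exists (x' - x.+1)%N; rewrite addnS -addSn subnKC.
rewrite {x' xx'}E.
elim: k x R => [|k IH] x R upR downR xR x'R bR.
  have DR : ((x%:Z, 0), false) \in R by apply: downR; lia.
  rewrite (@tilings_nb_branch R _ ((x%:Z + 1, 0), true) ((x%:Z, 1), true) DR).
  - rewrite addn1 big_nat1; have /negPf -> : ((x%:Z + 1, 0), true) \notin R.
      by move: x'R; rewrite (_ : (x + 1)%N%:Z = x%:Z + 1) //; lia.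
    rewrite mul0n add0n; congr (_ * tilings_nb _)%N; apply/fsetP => -[[u v] b].
    rewrite in_fsetD2 in_fset_sub !xpair_eqE /=.
    have [-> | ] := eqVneq ((u, v), b) ((x%:Z, 0), true); first by rewrite (negPf xR) !andbF.
    rewrite !xpair_eqE.
    by case: (_ \in R); rewrite ?andbT ?andbF //; case: b => /=; lia.
  - by rewrite !xpair_eqE; lia.
  - by rewrite share_edgeE /= !eqxx orbT.
  - by rewrite share_edgeE /= !eqxx !orbT.
  move=> e eR /down_neighbours; rewrite !inE add0r => /or3P[] /eqP E.
  - by rewrite E (negPf xR) in eR.
  - by rewrite E eqxx.
  by rewrite E eqxx orbT.
have DR : ((x%:Z, 0), false) \in R by apply: downR; lia.
have UR : ((x%:Z + 1, 0), true) \in R.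
  have := upR x.+1; rewrite (_ : x.+1%:Z = x%:Z + 1); last lia. apply; lia.
rewrite (@tilings_nb_branch R _ ((x%:Z + 1, 0), true) ((x%:Z, 1), true) DR); first last.
- move=> e eR /down_neighbours; rewrite !inE add0r => /or3P[] /eqP E.
  + by rewrite E (negPf xR) in eR.
  + by rewrite E eqxx.
  by rewrite E eqxx orbT.
- by rewrite share_edgeE /= !eqxx !orbT.
- by rewrite share_edgeE /= !eqxx orbT.
- by rewrite !xpair_eqE; lia.
rewrite UR mul1n addnC big_ltn; last lia. congr addn.
  congr (_ * _)%N; rewrite (@forced_left _ (x%:Z + 1) k.+1).
  - congr tilings_nb; apply/fsetP => -[[u v] b].
    rewrite !in_fset_sub in_fsetD2 !xpair_eqE /=.
    have [-> | ] := eqVneq ((u, v), b) ((x%:Z, 0), true); first by rewrite (negPf xR) !andbF.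
    rewrite !xpair_eqE.
    by case: (_ \in R); rewrite ?andbT ?andbF //; case: b => /=; lia.
  - move=> i Hi; rewrite !in_fsetD2 !xpair_eqE /= !andbF !andbT.
    have := upR `|i|%N; have := downR `|i|%N; rewrite (_ : `|i|%N%:Z = i); last lia.
    by move=> -> //; [move=> -> //; [split; lia | lia] | lia].
  - by rewrite addrK in_fsetD2 eqxx.
  - by move=> u; rewrite in_fsetD2 (negPf (bR u)) !andbF.
rewrite -addSnnS (IH x.+1).
- apply: eq_big_nat => y Hy; rewrite in_fsetD2 !xpair_eqE /= !andbF !andTb.
  congr (_ * tilings_nb _)%N; apply/fsetP => -[[u v] b].
  rewrite !in_fset_sub in_fsetD2 !xpair_eqE /=.
  have [-> | ] := eqVneq ((u, v), b) ((x%:Z, 0), true); first by rewrite (negPf xR) !andbF.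
  rewrite !xpair_eqE.
  by case: (_ \in R); rewrite ?andbT ?andbF //; case: b => /=; lia.
- by move=> i Hi; rewrite in_fsetD2 upR ?xpair_eqE /=; lia.
- by move=> i Hi; rewrite in_fsetD2 downR ?xpair_eqE /=; lia.
- by rewrite in_fsetD2 !xpair_eqE /= (_ : x.+1%:Z = x%:Z + 1) ?eqxx ?andbF //; lia.
- by rewrite addSnnS in_fsetD2 (negPf x'R) !andbF.
- by move=> u; rewrite in_fsetD2 (negPf (bR u)) !andbF.
Qed.

Lemma tilings_nb_bij (f g : cell -> cell) (R R' : {fset cell}) :
    cancel f g -> cancel g f ->
    (forall c d, share_edge (f c) (f d) = share_edge c d) ->
    (forall c, (f c \in R') = (c \in R)) ->
  tilings_nb R' = tilings_nb R.
Proof.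
move=> fK gK fE fR; rewrite -(tilings_nb_inj R (can_inj fK) fE).
congr tilings_nb; apply/fsetP => c; apply/idP/imfsetP => [cR'|[d /= dR ->]].
  by exists (g c); rewrite ?gK //= -fR gK.
by rewrite fR.
Qed.

Definition dent (v : int) (xs : seq nat) : pred cell :=
  fun c => [&& c.2, c.1.2 == v, 0 <= c.1.1 & `|c.1.1|%N \in xs].

(** Each gap between consecutive dents sends one lozenge upward, and beyond the last dent the row is
    forced. [e] tells whether row 1 is present: in the topmost row no lozenge can leave upward, so
    there must be a single dent. *)
Lemma strip_interlacings (R : {fset cell}) (x L : nat) xs (e : bool) :
    path ltn x xs -> all (fun i => i <= L)%N (x :: xs) ->
    (forall i : nat, (x <= i)%N ->
       (((i%:Z, 0), true) \in R) = [&& i != x, (i <= L)%N & i \notin xs]) ->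
    (forall i : nat, (x <= i)%N -> (((i%:Z, 0), false) \in R) = (i < L)%N) ->
    (forall i : nat, (x <= i < L)%N -> (((i%:Z, 1), true) \in R) = e) ->
    (forall u b, ((u, 0), b) \in R -> x%:Z <= u) ->
    (forall u, ((u, -1), false) \notin R) ->
  tilings_nb R = ((e || nilp xs) * \sum_(ys <- interlacings x xs)
    tilings_nb [fset c in R | (c.1.2 != 0%R) && ~~ dent 1 ys c])%N.
Proof.
elim: xs x R => [|x' xs IH] x R /=.
  move=> _; rewrite andbT => xL upR downR _ geR bR.
  rewrite orbT mul1n big_seq1 (@forced_right _ x%:Z (L - x)).
  - congr tilings_nb; apply/fsetP => -[[u v] b]; rewrite !in_fset_sub /dent /=.
    rewrite in_nil !andbF andbT.
    have [cR|] := boolP ((u, v, b) \in R) => //=.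
    have [v0|//] := eqVneq v 0; subst v.
    have ux := geR _ _ cR; case: b cR => cR /=.
      have := upR `|u|%N; rewrite (_ : `|u|%N%:Z = u); last lia.
      rewrite cR => /(_ ltac:(lia))/esym/and3P[]; lia.
    have := downR `|u|%N; rewrite (_ : `|u|%N%:Z = u); last lia.
    rewrite cR => /(_ ltac:(lia))/esym; lia.
  - move=> i Hi; have := upR (absz (i + 1)%R); rewrite (_ : (absz (i + 1)%R)%:Z = i + 1); last lia.
    have := downR `|i|%N; rewrite (_ : `|i|%N%:Z = i); last lia.
    by move=> -> ; last lia; move=> ->; last lia; split; lia.
  - have := downR L xL; rewrite (_ : x%:Z + (L - x)%N%:Z = L%:Z); last lia.
    by move=> ->; rewrite ltnn.
  exact: bR.
move=> /andP[xx' pxs] /and3P[xL x'L xsL] upR downR wR geR bR.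
have xsgt i : i \in xs -> (x' < i)%N.
  by move: pxs; rewrite path_sortedE; [case/andP=> /allP + _; apply | apply: ltn_trans].
rewrite orbF (@strip_segment R x x') //; first last.
- by rewrite upR ?inE ?eqxx ?orTb ?andbF // ltnW.
- by rewrite upR // eqxx.
- by move=> i Hi; rewrite downR; lia.
- move=> i Hi; rewrite upR; last lia.
  apply/and3P; split; [lia|lia|].
  by rewrite inE negb_or; apply/andP; split; [lia | apply/negP => /xsgt; lia].
rewrite big_allpairs_dep /= big_distrr /=; apply: eq_big_nat => y Hy.
rewrite wR; last lia. case: e wR IH => wR IH; last by rewrite !mul0n.
rewrite !mul1n (IH x') //=.
- rewrite mul1n; apply: eq_bigr => ys _; congr tilings_nb; apply/fsetP => -[[u v] b].
  rewrite !in_fset_sub !xpair_eqE /dent /= inE.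
  by case: (_ \in R); case: (_ \in ys); case: b => /=; lia.
- by rewrite x'L.
- move=> i Hi; rewrite in_fset_sub upR; last lia.
  rewrite !xpair_eqE /= inE negb_or; case: (i \in xs); rewrite ?andbF //=; lia.
- by move=> i Hi; rewrite in_fset_sub downR ?xpair_eqE /=; lia.
- by move=> i Hi; rewrite in_fset_sub wR ?xpair_eqE /=; lia.
- by move=> u b; rewrite in_fset_sub => /andP[/geR]; rewrite !xpair_eqE /=; lia.
- by move=> u; rewrite in_fset_sub (negPf (bR u)).
Qed.

Definition trapezoid (L N : nat) : {fset cell} := polygon 0 L%:Z 0 N%:Z 0 L%:Z.

Fact dented_key : unit. Proof. exact: tt. Qed.
(** Locked, so that membership is only unfolded through [in_dented], a formula fit for [lia]. *)
Definition dented (L N : nat) (xs : seq nat) : {fset cell} :=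
  locked_with dented_key [fset c in trapezoid L N | ~~ dent 0 xs c].

Lemma in_dented L N xs u v b : (((u, v), b) \in dented L N xs) =
  [&& 0 <= u, 0 <= v, v + 1 <= N%:Z, u + v + 1 + (~~ b)%:Z <= L%:Z &
      ~~ [&& b, v == 0 & `|u|%N \in xs]].
Proof.
rewrite /dented unlock in_fset_sub in_polygon /dent /=.
by case: (_ \in xs); case: b => /=; lia.
Qed.

Lemma dented_forced_left L N xs (x : nat) : (x < L)%N -> (0 < N)%N ->
    {in xs, forall i, x <= i}%N ->
  tilings_nb (dented L N xs) =
  tilings_nb [fset c in dented L N xs | ~~ ((c.1.2 == 0) && (0 <= c.1.1 < x%:Z))].
Proof.
move=> xL N0 xsx; rewrite (@forced_left _ 0 x) ?add0r //.
- move=> i Hi; rewrite !in_dented /=; split; last lia.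
  suff /negPf -> : `|i|%N \notin xs by lia.
  by apply/negP => /xsx; lia.
- by rewrite in_dented; lia.
- by move=> u; rewrite in_dented; lia.
Qed.

Lemma tilings_nb_dented_nil L N : (N < L)%N -> tilings_nb (dented L N.+1 [::]) = 0%N.
Proof.
case: L => // L NL; rewrite (@dented_forced_left _ _ _ L) //.
apply: (@tilings_nb_isolated _ ((L%:Z, 0), true)).
  by rewrite in_fset_sub in_dented /=; lia.
move=> e; rewrite in_fset_sub => /andP[eR]; apply: contraNN => /up_neighbours.
rewrite !inE => /or3P[] /eqP E; rewrite E in_dented /= in eR *; lia.
Qed.

(** The lozenges leaving row 0 upward become the dents of the trapezoid above it, whose base is
    shorter by one. *)
Lemma tilings_nb_dented_rec L N x xs :
    path ltn x xs -> all (fun i => i <= L)%N (x :: xs) ->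
  tilings_nb (dented L.+1 N.+1 (x :: xs)) =
  (((0 < N) || nilp xs) * \sum_(ys <- interlacings x xs) tilings_nb (dented L N ys))%N.
Proof.
move=> pxs xsL.
have xsgt i : i \in xs -> (x < i)%N.
  by move: pxs; rewrite path_sortedE; [case/andP=> /allP + _; apply | apply: ltn_trans].
rewrite (@dented_forced_left _ _ _ x) //; last first.
  by move=> i; rewrite inE => /orP[/eqP->|/xsgt/ltnW].
  by case/andP: xsL; rewrite ltnS.
rewrite (@strip_interlacings _ x L xs (0 < N)%N) //.
- congr (_ * _)%N; apply: eq_bigr => ys _.
  apply: (@tilings_nb_bij (fun c => ((c.1.1, c.1.2 + 1), c.2)) (fun c => ((c.1.1, c.1.2 - 1), c.2))).
  - by move=> [[u v] b] /=; rewrite addrK.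
  - by move=> [[u v] b] /=; rewrite subrK.
  - by move=> [[u v] b] [[u' v'] b']; rewrite !share_edgeE /=; case: b; case: b' => //=; lia.
  move=> [[u v] b]; rewrite !in_fset_sub !in_dented /dent /=.
  by case: (`|u|%N \in ys); case: (`|u|%N \in x :: xs); case: b => /=; lia.
- move=> i Hi; rewrite in_fset_sub in_dented /= inE.
  by case: (i \in xs); rewrite ?orbT ?orbF; lia.
- by move=> i Hi; rewrite in_fset_sub in_dented /=; lia.
- by move=> i Hi; rewrite in_fset_sub in_dented /=; lia.
- by move=> u b; rewrite in_fset_sub in_dented /=; lia.
- by move=> u; rewrite in_fset_sub in_dented /=; lia.
Qed.

Lemma mem_interlacings x xs ys : ys \in interlacings x xs ->
  [/\ size ys = size xs, sorted ltn ys, all (leq x) ys &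
      forall L, all (fun i => i <= L)%N (x :: xs) -> all (fun i => i < L)%N ys].
Proof.
elim: xs x ys => [|x' xs IH] x ys /=; first by rewrite inE => /eqP ->.
move=> /allpairsPdep[y [ys' [yx ys'x ->]]].
rewrite mem_index_iota in yx; case/andP: yx => xy yx'.
have [sys ys'_sorted /allP ys'_ge ys'_lt] := IH _ _ ys'x.
split=> /=; first by rewrite sys.
- rewrite path_sortedE; last exact: ltn_trans.
  by rewrite ys'_sorted andbT; apply/allP => i /ys'_ge; apply: leq_trans.
- by rewrite xy; apply/allP => i /ys'_ge /= x'i; apply: leq_trans x'i; lia.
move=> L /and3P[xL x'L xsL]; rewrite (leq_trans yx' x'L) ys'_lt //=.
by rewrite x'L.
Qed.

(** Each row absorbs one dent, whence the condition on the size. With no rows the region is empty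
    and has one tiling whatever [xs] is; the last hypothesis keeps this case consistent with the
    formula. *)
Lemma tilings_nb_dented_det L N xs :
    sorted ltn xs -> all (fun i => i < L)%N xs -> (N <= L)%N -> (N = 0 -> xs = [::])%N ->
  (tilings_nb (dented L N xs))%:R
  = (if size xs == N then binom_det N xs else 0) :> rat.
Proof.
elim: N L xs => [|N IH] L xs xs_sorted xsL NL xs0.
  rewrite (xs0 erefl) eqxx (_ : dented _ _ _ = fset0) ?tilings_nb0.
    by rewrite /binom_det det_mx00.
  apply/fsetP => -[[u v] b]; rewrite in_dented inE; lia.
case: L xsL NL => // L xsL NL.
case: xs xs_sorted xsL xs0 => [|x xs] xs_sorted xsL _.
  by rewrite tilings_nb_dented_nil // ltnS.
rewrite tilings_nb_dented_rec //= eqSS.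
have [N0|N0] := posnP N.
  subst N; case: xs xs_sorted xsL => [|x' xs] xs_sorted xsL; last by [].
  rewrite (@binom_det_interlacings x [::]) // mul1n /= !big_seq1.
  by rewrite IH.
rewrite mul1n natr_sum.
rewrite (eq_big_seq (fun ys => if size xs == N then binom_det N ys else 0)); last first.
  move=> ys /mem_interlacings[sy ys_sorted _ ys_lt].
  by rewrite IH // ?sy ?ys_lt //; lia.
case: eqP => [sN|_]; last by rewrite big1.
rewrite -sN binom_det_interlacings //.
by apply: sub_sorted xs_sorted => i j; apply: ltnW.
Qed.

Lemma perm_vdm xs ys : perm_eq xs ys -> vdm xs = vdm ys.
Proof.
by move=> xy; rewrite /vdm (perm_big _ xy); apply: eq_bigr => i _; rewrite (perm_big _ xy).
Qed.

Lemma tilings_nb_dented L N xs :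
    uniq xs -> all (fun i => i < L)%N xs -> (N <= L)%N -> (N = 0 -> xs = [::])%N ->
  (tilings_nb (dented L N xs) * hyperfact N = (size xs == N) * vdm xs)%N.
Proof.
move=> uxs xsL NL xs0; pose ys := sort leq xs.
have pxy : perm_eq ys xs by apply/permPl/perm_sort.
have ys_sorted : sorted ltn ys.
  by rewrite ltn_sorted_uniq_leq sort_uniq uxs sort_sorted //; apply: leq_total.
have -> : dented L N xs = dented L N ys.
  by apply/fsetP => -[[u v] b]; rewrite !in_dented (perm_mem pxy).
rewrite -(perm_vdm pxy) -(perm_size pxy).
apply/eqP; rewrite -(eqr_nat rat) !natrM tilings_nb_dented_det //; first last.
- by move=> /xs0 E; apply/nilP; rewrite /nilp (perm_size pxy) E.
- by rewrite (perm_all _ pxy).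
apply/eqP; have [sN|_] := eqVneq (size ys) N; last by rewrite !mul0r.
by rewrite -sN binom_det_vdm // mul1r.
Qed.

(** * Triangular dents standing on the base *)

Lemma in_triangle_up (u v i j : int) b (p : nat) :
  (((u, v), b) \in triangle true i j p%:Z) =
  [&& i <= u, j <= v & u + v + 1 + (~~ b)%:Z <= i + j + p%:Z].
Proof. by rewrite /triangle in_polygon; case: b => /=; lia. Qed.

Lemma in_triangle_down (u v i j : int) b (p : nat) :
  (((u, v), b) \in triangle false i j p%:Z) =
  [&& u + 1 <= i + p%:Z, v + 1 <= j & i + j <= u + v + (~~ b)%:Z].
Proof. by rewrite /triangle in_polygon; case: b => /=; lia. Qed.

Lemma forced_above (R : {fset cell}) (i v : int) (k : nat) :
    (forall u, i <= u <= i + k%:Z -> ((u, v), true) \notin R) ->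
    (forall u, i <= u < i + k%:Z ->
       ((u, v), false) \in R /\ ((u, v + 1), true) \in R) ->
  tilings_nb R = tilings_nb [fset c in R |
    ~~ ((i <= c.1.1 < i + k%:Z) && (c.1.2 == v + (c.2)%:Z))].
Proof.
elim: k R => [|k IH] R notR inR.
  congr tilings_nb; apply/fsetP => -[[u' v'] b]; rewrite in_fset_sub /=.
  by rewrite (_ : (_ <= _ < _) && _ = false) ?andbT //; lia.
have [DR UR] := inR (i + k%:Z) ltac:(lia).
rewrite (tilings_nb_forced DR UR); first last.
- move=> e eR /down_neighbours; rewrite !inE => /or3P[] /eqP E //.
  + by rewrite E (negPf (notR _ _)) in eR; lia.
  + by rewrite E (negPf (notR _ _)) in eR; lia.
- by rewrite share_edgeE /= !eqxx !orbT.
rewrite IH.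
- congr tilings_nb; apply/fsetP => -[[u' v'] b].
  rewrite !in_fset_sub in_fsetD2 !xpair_eqE /=.
  by case: (_ \in R); rewrite ?andbT ?andbF //; case: b => /=; lia.
- by move=> u Hu; rewrite in_fsetD2 (negPf (notR _ _)) ?andbF //; lia.
move=> u Hu; rewrite !in_fsetD2 !xpair_eqE /= !andbF !andbT.
have [-> ->] := inR u ltac:(lia); split; lia.
Qed.

(* If the base cells of an up-pointing triangle are missing, the rest of the
   triangle is tiled in a unique way, row after row. *)
Lemma tilings_nb_triangle (R : {fset cell}) (i v : int) (p : nat) :
    (forall u, i <= u < i + p%:Z -> ((u, v), true) \notin R) ->
    (forall c, c \in triangle true i v p%:Z -> ~~ ((c.1.2 == v) && c.2) -> c \in R) ->
  tilings_nb R = tilings_nb (R `\` triangle true i v p%:Z).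
Proof.
elim: p R v => [|p IH] R v notR inR.
  congr tilings_nb; apply/fsetP => -[[u' v'] b]; rewrite in_fsetD in_triangle_up.
  by rewrite (_ : [&& _, _ & _] = false) //; lia.
rewrite (@forced_above R i v p).
- rewrite (IH _ (v + 1)).
  + congr tilings_nb; apply/fsetP => -[[u' v'] b].
    rewrite !in_fsetD in_fset_sub !in_triangle_up /=.
    have [cR|] := boolP (_ \in R); rewrite ?andbF ?andbT //.
    have : ~~ [&& b, v' == v, i <= u' & u' < i + p.+1%:Z].
      by apply/negP => /and4P[Hb /eqP Hv ? ?]; move: cR; rewrite Hb Hv (negPf (notR _ _)) //; lia.
    by case: b {cR} => /=; lia.
  + by move=> u Hu; rewrite in_fset_sub /= negb_and; apply/negP; lia.
  move=> [[u' v'] b]; rewrite in_triangle_up in_fset_sub /= => Hc Hb.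
  rewrite inR ?in_triangle_up /=; first by case: b Hc Hb => /=; lia.
    by case: b Hc Hb => /=; lia.
  by case: b Hc Hb => /=; lia.
- by move=> u Hu; apply: notR; lia.
- by move=> u Hu; split; apply: inR; rewrite ?in_triangle_up /=; lia.
Qed.

(** A pair holds the start and the length of a run of positions, the horizontal side of a removed
    triangle. *)
Definition block_positions (bs : seq (nat * nat)) : seq nat :=
  flatten [seq iota b.1 b.2 | b <- bs].

Definition in_triangles (bs : seq (nat * nat)) (c : cell) : bool :=
  has (fun b : nat * nat => c \in triangle true b.1%:Z 0 b.2%:Z) bs.

Lemma in_trianglesP bs u v b : reflect
  (exists2 d, d \in bs & [/\ d.1%:Z <= u, 0 <= v & u + v + 1 + (~~ b)%:Z <= d.1%:Z + d.2%:Z])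
  (in_triangles bs ((u, v), b)).
Proof.
apply: (iffP hasP) => -[d dbs Hd]; exists d => //.
  by move: Hd; rewrite /= in_triangle_up addr0 => /and3P.
by rewrite /= in_triangle_up addr0; apply/and3P.
Qed.

Lemma mem_block_positions bs (x : nat) : reflect
  (exists2 d, d \in bs & (d.1 <= x < d.1 + d.2)%N) (x \in block_positions bs).
Proof.
apply: (iffP flatten_mapP) => -[d dbs Hd]; exists d => //; move: Hd.
  by rewrite mem_iota.
by rewrite mem_iota.
Qed.

(** A run of unit dents forces the whole triangle above it; triangles on disjoint runs are disjoint,
    so they are removed one at a time. *)
Lemma tilings_nb_remove_triangles L N xs bs :
    uniq (block_positions bs) -> {subset block_positions bs <= xs} ->
    all (fun d : nat * nat => (d.2 <= N) && (d.1 + d.2 <= L))%N bs ->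
  tilings_nb (dented L N xs)
  = tilings_nb [fset c in dented L N xs | ~~ in_triangles bs c].
Proof.
elim: bs => [|d bs IH] /=.
  by move=> _ _ _; congr tilings_nb; apply/fsetP => c; rewrite in_fset_sub andbT.
rewrite /block_positions /= cat_uniq => /and3P[_ disj ubs] sub /andP[/andP[dN dL] bsL].
rewrite IH //; last by move=> x xbs; apply: sub; rewrite mem_cat xbs orbT.
rewrite (@tilings_nb_triangle _ d.1%:Z 0 d.2).
- congr tilings_nb; apply/fsetP => c.
  rewrite in_fsetD [X in _ && X]in_fset_sub [RHS]in_fset_sub /=.
  by rewrite negb_or [RHS]andbCA.
- move=> u Hu; rewrite in_fset_sub in_dented eqxx /= (_ : _ \in xs) ?andbF //.
  by apply: sub; rewrite mem_cat mem_iota; lia.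
move=> [[u v] b]; rewrite in_triangle_up addr0 /= => Hc Hb.
rewrite in_fset_sub in_dented; apply/andP; split.
  by case: (_ \in xs); case: b Hb Hc => /=; lia.
apply/negP => /in_trianglesP[d' d'bs [? ? ?]].
move/hasP: disj; apply; exists `|u|%N; last by rewrite /= mem_iota; lia.
by apply/mem_block_positions; exists d' => //; lia.
Qed.

(** The form in which a half of a region occurs: [bs] are its removed triangles and [ss] the unit
    dents left by the lozenges that cross the line. *)
Lemma tilings_nb_dented_blocks L N bs ss :
    uniq (block_positions bs ++ ss) -> all (fun i => i < L)%N ss ->
    all (fun d : nat * nat => (d.2 <= N) && (d.1 + d.2 <= L))%N bs ->
    (N <= L)%N -> (N = 0 -> ss = [::])%N ->
  (tilings_nb [fset c in dented L N ss | ~~ in_triangles bs c] * hyperfact N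
   = (size (block_positions bs ++ ss) == N) * vdm (block_positions bs ++ ss))%N.
Proof.
move=> ubs ssL bsL NL ss0.
have bsP x : x \in block_positions bs -> (x < L)%N /\ (0 < N)%N.
  by move=> /mem_block_positions[d /(allP bsL) Hd]; lia.
rewrite -(@tilings_nb_dented L) //.
- congr (_ * _)%N; rewrite [RHS](@tilings_nb_remove_triangles _ _ _ bs) //.
  + congr tilings_nb; apply/fsetP => -[[u v] b]; rewrite !in_fset_sub !in_dented mem_cat.
    have [|nt] := boolP (in_triangles _ _); rewrite ?andbF ?andbT //.
    have [/mem_block_positions[d dbs Hd]|] := boolP (`|u|%N \in block_positions bs); last by [].
    rewrite orTb andbT.
    have [/andP[Hb Hv]|/negPf nb] := boolP (b && (v == 0)); last first.
      by rewrite !andbA nb.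
    apply/idP/idP => /and5P[u0 *]; case/in_trianglesP: nt; exists d => //;
      by move: Hb => -> /=; split; lia.
  + by move: ubs; rewrite cat_uniq => /andP[].
  by move=> x xbs; rewrite mem_cat xbs.
- by rewrite all_cat ssL andbT; apply/allP => x /bsP[].
move=> N0; rewrite (ss0 N0) cats0.
case E: (block_positions bs) => [//|x l].
by have [] := bsP x; rewrite ?N0 // E mem_head.
Qed.

(** * Cutting along a horizontal line *)

(** Each factor is the distance |i - j|, as one of the truncated differences is zero. *)
Definition cross (xs ys : seq nat) : nat :=
  (\prod_(i <- xs) \prod_(j <- ys) ((i - j) + (j - i)))%N.

Lemma perm_cross xs xs' ys : perm_eq xs xs' -> cross xs ys = cross xs' ys.
Proof. exact: perm_big. Qed.

Lemma cross_catl xs xs' ys : cross (xs ++ xs') ys = (cross xs ys * cross xs' ys)%N.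
Proof. exact: big_cat. Qed.

Lemma vdm_cat xs ys : uniq (xs ++ ys) ->
  vdm (xs ++ ys) = (vdm xs * vdm ys * cross xs ys)%N.
Proof.
rewrite cat_uniq => /and3P[_ /hasPn disj _].
rewrite /vdm big_cat /=.
rewrite (eq_bigr (fun i => (\prod_(j <- xs | i < j) (j - i) * \prod_(j <- ys | i < j) (j - i)))%N);
  last by move=> i _; rewrite big_cat.
rewrite [X in (_ * X)%N](eq_bigr (fun i =>
  (\prod_(j <- xs | i < j) (j - i) * \prod_(j <- ys | i < j) (j - i)))%N);
  last by move=> i _; rewrite big_cat.
rewrite !big_split /= [X in (_ * X)%N]mulnC mulnACA; congr muln.
rewrite [X in (_ * X)%N](exchange_big_dep xpredT) //= -big_split /=.
apply: eq_big_seq => i ixs; rewrite big_mkcond [X in (_ * X)%N]big_mkcond -big_split /=.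
apply: eq_big_seq => j jys; have := disj _ jys.
case: (ltngtP i j) => [||ij]; last by rewrite -ij ixs.
  by rewrite muln1; lia.
by rewrite mul1n; lia.
Qed.

Lemma vdm_rev K xs : all (fun i => i < K)%N xs ->
  vdm [seq (K.-1 - i)%N | i <- xs] = vdm xs.
Proof.
move=> /allP xsK; rewrite /vdm big_map.
rewrite (eq_bigr (fun i => \prod_(j <- xs | K.-1 - i < K.-1 - j) ((K.-1 - j) - (K.-1 - i)))%N);
  last by move=> i _; rewrite big_map.
rewrite [RHS](exchange_big_dep xpredT) //=.
apply: eq_big_seq => i /xsK iK; rewrite big_seq_cond [RHS]big_seq_cond.
by apply: eq_big => [j|j /andP[/xsK jK _]]; [case: (boolP (j \in xs)) => [/xsK|//] |]; lia.
Qed.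

Definition positions (K : nat) (S : {set 'I_K}) : seq nat := [seq val i | i <- enum S].

Lemma mem_positions K (S : {set 'I_K}) i : (val i \in positions S) = (i \in S).
Proof. by rewrite mem_map ?mem_enum //; apply: val_inj. Qed.

Lemma positionsP K (S : {set 'I_K}) (k : nat) :
  reflect (exists2 i : 'I_K, i \in S & k = val i) (k \in positions S).
Proof.
apply: (iffP mapP) => -[i iS ->]; exists i => //; first by rewrite mem_enum in iS.
by rewrite mem_enum.
Qed.

Lemma uniq_positions K (S : {set 'I_K}) : uniq (positions S).
Proof. by rewrite map_inj_uniq ?enum_uniq //; apply: val_inj. Qed.

Lemma size_positions K (S : {set 'I_K}) : size (positions S) = #|S|.
Proof. by rewrite size_map -cardE. Qed.

(* [xs] lists the positions of the cutting line that no lozenge can cross, and [S]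
   those that are crossed. *)
Definition crossing_sum (z K : nat) (xs : seq nat) : nat :=
  (\sum_(S : {set 'I_K} | [forall i in S, val i \notin xs] && (#|S| == z))
     vdm (positions S) ^ 2 * cross xs (positions S))%N.

Lemma perm_crossing_sum z K xs ys :
  perm_eq xs ys -> crossing_sum z K xs = crossing_sum z K ys.
Proof.
move=> xy; apply: eq_big => S; last by rewrite (perm_cross _ xy).
by congr (_ && _); apply: eq_forallb => i; rewrite (perm_mem xy).
Qed.

Lemma size_block_positions bs : size (block_positions bs) = sumn [seq d.2 | d <- bs].
Proof. by elim: bs => //= d bs IH; rewrite /block_positions /= size_cat size_iota IH. Qed.

Lemma leq_block_size bs (d : nat * nat) :
  d \in bs -> (d.2 <= size (block_positions bs))%N.
Proof.
rewrite size_block_positions; elim: bs => //= e bs IH.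
by rewrite inE => /orP[/eqP ->|/IH]; lia.
Qed.

Lemma perm_rev_block_positions K bs :
    all (fun d : nat * nat => d.1 + d.2 <= K)%N bs ->
  perm_eq (block_positions [seq ((K - d.1 - d.2)%N, d.2) | d <- bs])
          [seq (K.-1 - i)%N | i <- block_positions bs].
Proof.
elim: bs => //= d bs IH /andP[dK bsK]; rewrite /block_positions /= map_cat.
apply: perm_cat; last exact: IH.
apply: uniq_perm; first exact: iota_uniq.
  rewrite map_inj_in_uniq ?iota_uniq // => i j; rewrite !mem_iota; lia.
move=> i; rewrite mem_iota; apply/idP/mapP => [Hi|[j]].
  by exists (K.-1 - i)%N; rewrite ?mem_iota; lia.
by rewrite mem_iota; lia.
Qed.

Lemma in_triangles_base bs (i : nat) :
  in_triangles bs ((i%:Z, 0), true) = (i \in block_positions bs).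
Proof.
apply/in_trianglesP/mem_block_positions => -[[j k] dbs /= Hd]; exists (j, k) => //=.
  by case: Hd; lia.
by split; lia.
Qed.

Lemma in_triangles_cons d bs c : in_triangles (d :: bs) c =
  (c \in triangle true d.1%:Z 0 d.2%:Z) || in_triangles bs c.
Proof. by []. Qed.

Lemma mem_rev_positions K xs (u : nat) : all (fun i => i < K)%N xs -> (u < K)%N ->
  (u \in [seq (K.-1 - i)%N | i <- xs]) = ((K.-1 - u)%N \in xs).
Proof.
move=> /allP xsK uK; apply/mapP/idP => [[i ixs ->]|Hu].
  by rewrite (_ : (_ - _)%N = i) //; have := xsK _ ixs; lia.
by exists (K.-1 - u)%N => //; lia.
Qed.

(** The line is v = -h, in a hexagon with west vertex (0, 0) and east vertex (h+m+r, -h-r). It meets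
    the hexagon in the positions from [h] to [h + m], and the completing triangles extend it to
    h+m+r positions. [us] and [ds] are the triangles removed above and below the line. The
    conditions on [n1] and [n2] say that with [z] crossings each completed half has as many dents as
    rows. *)
Lemma region_count (h m r n1 n2 z : nat) (us ds : seq (nat * nat)) (R : {fset cell}) :
    (forall u v b, ((u, v), b) \in R =
       [&& 0 <= u, u + 1 <= (h + m + r)%:Z, - (h + n2)%:Z <= v,
           v + 1 <= n1%:Z - h%:Z, 0 <= u + v + (~~ b)%:Z,
           u + v + 1 + (~~ b)%:Z <= m%:Z,
           ~~ has (fun d : nat * nat => ((u, v), b) \in triangle true d.1%:Z (- h%:Z) d.2%:Z) us &
           ~~ has (fun d : nat * nat => ((u, v), b) \in triangle false d.1%:Z (- h%:Z) d.2%:Z) ds]) ->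
    let U := block_positions ((0, h)%N :: us) in
    let D := block_positions ((h + m, r)%N :: ds) in
    uniq (U ++ D) ->
    all (fun d : nat * nat => (h <= d.1) && (d.1 + d.2 <= h + m))%N (us ++ ds) ->
    (size U + z = n1)%N -> (size D + z = n2)%N -> (n1 <= h + m)%N -> (n2 <= m + r)%N ->
  (tilings_nb R * (hyperfact n1 * hyperfact n2)
   = vdm U * vdm D * crossing_sum z (h + m + r) (U ++ D))%N.
Proof.
have [K KE] : {K | K = (h + m + r)%N} by exists (h + m + r)%N.
rewrite -KE => RE; set bU := _ :: us; set bD := _ :: ds => U D uUD bsP sU sD n1L n2L.
pose P := [fset c in R | - h%:Z <= c.1.2].
pose Q := [fset c in R | c.1.2 < - h%:Z].
(* Position [i] of the line separates the up cell [p i] above it from the down cell [q i] below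
   it. *)
pose p (i : 'I_K) : cell := (((val i)%:Z, - h%:Z), true).
pose q (i : 'I_K) : cell := (((val i)%:Z, - h%:Z - 1), false).
have usP (d : nat * nat) : d \in us -> (h <= d.1)%N && (d.1 + d.2 <= h + m)%N.
  by move=> dus; apply: (allP bsP); rewrite mem_cat dus.
have dsP (d : nat * nat) : d \in ds -> (h <= d.1)%N && (d.1 + d.2 <= h + m)%N.
  by move=> dds; apply: (allP bsP); rewrite mem_cat dds orbT.
have upE u v b : has (fun d : nat * nat => ((u, v), b) \in triangle true d.1%:Z (- h%:Z) d.2%:Z) us
   = in_triangles us ((u, v + h%:Z), b).
  by apply: eq_has => d; rewrite !in_triangle_up; lia.
have downE u v b : has (fun d : nat * nat => ((u, v), b) \in triangle false d.1%:Z (- h%:Z) d.2%:Z) ds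
   = in_triangles [seq ((K - d.1 - d.2)%N, d.2) | d <- ds] ((K%:Z - 1 - u, - h%:Z - 1 - v), ~~ b).
  rewrite /in_triangles has_map; apply: eq_in_has => -[i k] /dsP /= dK.
  by rewrite [LHS]in_triangle_down [RHS]in_triangle_up; case: b => /=; lia.
have PE u v b : (((u, v), b) \in P) = [&& 0 <= u, - h%:Z <= v, v + 1 <= n1%:Z - h%:Z,
     0 <= u + v + (~~ b)%:Z, u + v + 1 + (~~ b)%:Z <= m%:Z & ~~ in_triangles us ((u, v + h%:Z), b)].
  rewrite in_fset_sub RE upE.
  have [Hv|Hv] := boolP (- h%:Z <= (u, v, b).1.2); last first.
    by rewrite andbF; apply/esym/negP => /and3P[_ Hv' _]; rewrite /= in Hv; lia.
  rewrite andbT.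
  have -> : has (fun d : nat * nat => ((u, v), b) \in triangle false d.1%:Z (- h%:Z) d.2%:Z) ds = false.
    by apply/negP => /hasP[d _]; rewrite in_triangle_down /= in Hv *; lia.
  rewrite andbT; case: (in_triangles _ _); rewrite ?andbF //= in Hv *.
  by case: b => /=; lia.
have QE u v b : (((u, v), b) \in Q) = [&& u + 1 <= K%:Z, v < - h%:Z, - (h + n2)%:Z <= v,
     0 <= u + v + (~~ b)%:Z, u + v + 1 + (~~ b)%:Z <= m%:Z &
     ~~ in_triangles [seq ((K - d.1 - d.2)%N, d.2) | d <- ds] ((K%:Z - 1 - u, - h%:Z - 1 - v), ~~ b)].
  rewrite in_fset_sub RE downE.
  have [Hv|Hv] := boolP ((u, v, b).1.2 < - h%:Z); last first.
    by rewrite andbF; apply/esym/negP => /and3P[_ Hv' _]; rewrite /= in Hv; lia.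
  rewrite andbT.
  have -> : has (fun d : nat * nat => ((u, v), b) \in triangle true d.1%:Z (- h%:Z) d.2%:Z) us = false.
    by apply/negP => /hasP[d _]; rewrite in_triangle_up /= in Hv *; lia.
  rewrite andTb; case: (in_triangles _ _); rewrite ?andbF //= ?andbT in Hv *.
  by case: b => /=; lia.
have -> : R = P `|` Q.
  apply/fsetP => -[[u v] b]; rewrite in_fsetU [X in _ = X || _]in_fset_sub [X in _ = _ || X]in_fset_sub /=.
  by case: (_ \in R); rewrite //=; lia.
rewrite (@tilings_nb_cut _ p q); first last.
- move=> [[u v] b] [[u' v'] b']; rewrite PE QE share_edgeE /= => HP HQ.
  case: b b' HP HQ => [] [] //= HP HQ Hadj; last by lia.
  have uK : (`|u| < K)%N by lia.
  by exists (Ordinal uK); rewrite /p /q /=; congr (_, _, _); lia.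
- by move=> i; rewrite share_edgeE /= !eqxx !orbT.
- apply/fdisjointP => -[[u v] b]; rewrite PE QE => HP; apply/negP; lia.
- by move=> i j [] /val_inj.
- by move=> i j [] /val_inj.
pose ok (S : {set 'I_K}) := [forall i in S, (p i \in P) && (q i \in Q)].
have inpS (S : {set 'I_K}) u v b : (((u, v), b) \in [fset p i | i in S]) =
    [&& b, v == - h%:Z, 0 <= u & `|u|%N \in positions S].
  apply/imfsetP/and4P => [[i /= iS [-> -> ->]]|[Hb /eqP -> u0 /positionsP[i iS ui]]].
    by rewrite eqxx absz_nat mem_positions iS.
  by exists i => //=; rewrite /p -ui Hb; congr (_, _, _); lia.
have inqS (S : {set 'I_K}) u v b : (((u, v), b) \in [fset q i | i in S]) =
    [&& ~~ b, v == - h%:Z - 1, 0 <= u & `|u|%N \in positions S].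
  apply/imfsetP/and4P => [[i /= iS [-> -> ->]]|[Hb /eqP -> u0 /positionsP[i iS ui]]].
    by rewrite eqxx absz_nat mem_positions iS.
  by exists i => //=; rewrite /q -ui (negPf Hb); congr (_, _, _); lia.
have Kpos : {in U ++ D, forall i, (i < K)%N}.
  move=> i; rewrite mem_cat => /orP[] /mem_block_positions[d]; rewrite inE => /orP[/eqP->|].
  - by rewrite /=; lia.
  - by move/usP; lia.
  - by rewrite /=; lia.
  - by move/dsP; lia.
have mem_ds (i : 'I_K) : in_triangles [seq ((K - d.1 - d.2)%N, d.2) | d <- ds]
    ((K%:Z - 1 - (val i)%:Z, - h%:Z - 1 - (- h%:Z - 1)), true) = (val i \in block_positions ds).
  rewrite -(downE _ _ false); apply/hasP/mem_block_positions => -[[j k] dds Hd]; exists (j, k) => //.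
    by move: Hd; rewrite /= in_triangle_down; lia.
  by move: Hd; rewrite /= in_triangle_down; lia.
have UE (i : nat) : (i \in U) = (i < h)%N || (i \in block_positions us).
  by rewrite /U /block_positions /= mem_cat mem_iota.
have DE (i : nat) : (i \in D) = (h + m <= i < h + m + r)%N || (i \in block_positions ds).
  by rewrite /D /block_positions /= mem_cat mem_iota.
have pqE (i : 'I_K) : (p i \in P) && (q i \in Q) =
    [&& val i \notin U ++ D, (h <= i < h + m)%N, (0 < n1)%N & (0 < n2)%N].
  rewrite PE QE addNr in_triangles_base mem_ds mem_cat UE DE /=; have iK := ltn_ord i.
  by case: (_ \in _); case: (_ \in _); lia.
have okP (S : {set 'I_K}) : ok S ->
    {in S, forall i : 'I_K, [/\ val i \notin U ++ D, (h <= i < h + m)%N, (0 < n1)%N & (0 < n2)%N]}.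
  by move=> /forall_inP okS i /okS; rewrite pqE => /and4P.
(* An element of [S] makes z, hence [n1] and [n2], positive; and avoiding [U ++ D] already keeps a
   position inside the hexagon, because the completing triangles are blocks of [U] and [D]. *)
have okE (S : {set 'I_K}) : #|S| = z -> ok S = [forall i in S, val i \notin U ++ D].
  move=> Sz; apply: eq_forallb => i; have [iS|//] := boolP (i \in S); rewrite /= pqE.
  have z0 : (0 < z)%N by rewrite -Sz card_gt0; apply/set0Pn; exists i.
  have [//|] := boolP (val i \in U ++ D); rewrite mem_cat UE DE /=; have iK := ltn_ord i.
  by case: (_ \in _); case: (_ \in _); lia.
have uS (S : {set 'I_K}) V : ok S -> {subset V <= U ++ D} -> uniq V -> uniq (V ++ positions S).
  move=> okS sV uV; rewrite cat_uniq uV uniq_positions andbT /=.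
  apply/hasPn => _ /positionsP[i iS ->]; have [+ _ _ _] := okP S okS i iS.
  by apply: contra; apply: sV.
have [uU uD] : uniq U /\ uniq D by move: uUD; rewrite cat_uniq => /and3P[].
have sUUD : {subset U <= U ++ D} by move=> i iU; rewrite mem_cat iU.
have sDUD : {subset D <= U ++ D} by move=> i iD; rewrite mem_cat iD orbT.
have posK (S : {set 'I_K}) : all (fun i => i < K)%N (positions S).
  by apply/allP => _ /positionsP[i _ ->]; apply: ltn_ord.
have upper (S : {set 'I_K}) : ok S -> (tilings_nb (P `\` [fset p i | i in S]) * hyperfact n1
   = (#|S| == z) * vdm (U ++ positions S))%N.
  move=> okS.
  rewrite (@tilings_nb_bij (fun c => ((c.1.1, c.1.2 - h%:Z), c.2)) (fun c => ((c.1.1, c.1.2 + h%:Z), c.2))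
     [fset c in dented (h + m) n1 (positions S) | ~~ in_triangles bU c]); first last.
  - move=> [[u v] b]; rewrite in_fsetD inpS PE in_fset_sub in_dented subrK.
    rewrite in_triangles_cons in_triangle_up /=.
    case: (in_triangles _ _); rewrite ?orbT ?andbF ?orbF ?andbT //.
    by case: (_ \in positions S); case: b => /=; lia.
  - by move=> [[u v] b] [[u' v'] b']; rewrite !share_edgeE /=; case: b; case: b' => //=; lia.
  - by move=> [[u v] b] /=; rewrite addrK.
  - by move=> [[u v] b] /=; rewrite subrK.
  rewrite tilings_nb_dented_blocks //.
  - by rewrite size_cat size_positions -/U -sU eqn_add2l.
  - exact: uS.
  - by apply/allP => _ /positionsP[i iS ->]; have [_ /andP[]] := okP S okS i iS.
  - apply/allP => -[j k] dU; have := leq_block_size dU; rewrite -/U => /= kU.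
    by move: dU; rewrite inE xpair_eqE => /orP[|/usP /=]; lia.
  move=> n10; case E: (positions S) => [//|i l]; have : i \in positions S by rewrite E mem_head.
  by move=> /positionsP[i' i'S _]; have [_ _ + _] := okP S okS i' i'S; rewrite n10.
have lower (S : {set 'I_K}) : ok S -> (tilings_nb (Q `\` [fset q i | i in S]) * hyperfact n2
   = (#|S| == z) * vdm (D ++ positions S))%N.
  (* The half-turn [f] stands the lower half upright; on positions it is i -> K-1-i, which preserves
     [vdm]. *)
  move=> okS; pose f (c : cell) : cell := ((K%:Z - 1 - c.1.1, - h%:Z - 1 - c.1.2), ~~ c.2).
  have fK : cancel f f by move=> [[u v] b]; rewrite /f /= negbK; congr (_, _, _); lia.
  pose bD' := [seq ((K - d.1 - d.2)%N, d.2) | d <- bD].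
  pose ss := [seq (K.-1 - i)%N | i <- positions S].
  have DK : all (fun i => i < K)%N (D ++ positions S).
    by rewrite all_cat posK andbT; apply/allP => i iD; apply: Kpos; apply: sDUD.
  have pD : perm_eq (block_positions bD' ++ ss) [seq (K.-1 - i)%N | i <- D ++ positions S].
    rewrite map_cat perm_cat2r; apply: perm_rev_block_positions.
    by apply/allP => -[j k]; rewrite inE xpair_eqE => /orP[|/dsP] /=; lia.
  rewrite (@tilings_nb_bij f f [fset c in dented (m + r) n2 ss | ~~ in_triangles bD' c]) //; first last.
  - move=> [[u v] b]; rewrite in_fsetD inqS QE in_fset_sub in_dented !negbK.
    rewrite in_triangles_cons in_triangle_up /=.
    rewrite (_ : K%:Z - 1 - (K%:Z - 1 - u) = u); last lia.
    rewrite (_ : - h%:Z - 1 - (- h%:Z - 1 - v) = v); last lia.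
    case: (in_triangles _ _); rewrite ?orbT ?andbF ?orbF ?andbT //.
    have [uK|uK] := boolP (0 <= u < K%:Z); last by case: b => /=; lia.
    rewrite mem_rev_positions //; last lia.
    rewrite (_ : absz (K%:Z - 1 - u)%R = (K.-1 - `|u|)%N); last lia.
    by case: (_ \in positions S); case: b => /=; lia.
  - by move=> [[u v] b] [[u' v'] b']; rewrite !share_edgeE /=; case: b; case: b' => //=; lia.
  rewrite tilings_nb_dented_blocks //.
  - rewrite (perm_vdm pD) vdm_rev // (perm_size pD) size_map.
    by rewrite size_cat size_positions -sD eqn_add2l.
  - rewrite (perm_uniq pD) map_inj_in_uniq; first exact: uS.
    by move=> i j /(allP DK) iK /(allP DK) jK; lia.
  - apply/allP => _ /mapP[_ /positionsP[i iS ->] ->]; have [_ + _ _] := okP S okS i iS.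
    by have := ltn_ord i; rewrite /=; lia.
  - apply/allP => _ /mapP[[j k] dD ->]; have := leq_block_size dD; rewrite -/D => /= kD.
    by move: dD; rewrite inE xpair_eqE => /orP[|/dsP /=]; lia.
  move=> n20; rewrite /ss; case E: (positions S) => [//|i l]; have : i \in positions S by rewrite E mem_head.
  by move=> /positionsP[i' i'S _]; have [_ _ _] := okP S okS i' i'S; rewrite n20.
rewrite big_distrl big_distrr /= (bigID (fun S : {set 'I_K} => #|S| == z)) /=.
(* Sets of another size contribute zero, since the numbers of dents and rows of the upper half then
   differ. *)
rewrite [X in (_ + X)%N]big1 ?addn0; last first.
  move=> S /andP[okS /negPf nz]; rewrite mulnACA upper // nz mul0n //.
apply: eq_big => S.
  by case: eqP => [/okE <-|]; rewrite ?andbF.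
move=> /andP[okS Sz]; rewrite mulnACA upper // lower // Sz !mul1n.
rewrite (vdm_cat (uS S U okS sUUD uU)) (vdm_cat (uS S D okS sDUD uD)).
rewrite cross_catl expnS expn1.
by move: (vdm U) (vdm D) (vdm _) (cross U _) (cross D _) => A B C E G; ring.
Qed.

(** * Ferns *)

(* The triangles of a fern on the positions [i, i + sumn t[ that have a given
   orientation; [b] tells whether the leftmost triangle has this orientation. *)
Fixpoint fern_blocks (b : bool) (i : nat) (t : seq nat) : seq (nat * nat) :=
  if t is p :: t' then
    if b then (i, p) :: fern_blocks false (i + p) t' else fern_blocks true (i + p) t'
  else [::].

Lemma fern_blocks_cat b i s t : fern_blocks b i (s ++ t) =
  fern_blocks b i s ++ fern_blocks (b (+) odd (size s)) (i + sumn s) t.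
Proof.
elim: s b i => [|p s IH] b i; first by rewrite /= addbF addn0.
by case: b; rewrite /= IH ?cat_cons addnA; congr cons || idtac;
   congr (_ ++ fern_blocks _ _ _); case: (odd _).
Qed.

Lemma block_positions_cat bs bs' :
  block_positions (bs ++ bs') = block_positions bs ++ block_positions bs'.
Proof. by rewrite /block_positions map_cat flatten_cat. Qed.

Lemma block_positions_cons d bs :
  block_positions (d :: bs) = iota d.1 d.2 ++ block_positions bs.
Proof. by []. Qed.

(** This is why only the total length of a fern matters: each position of its segment bounds exactly
    one triangle, pointing up or down. *)
Lemma perm_fern_positions b i t :
  perm_eq (block_positions (fern_blocks b i t) ++ block_positions (fern_blocks (~~ b) i t))
          (iota i (sumn t)).
Proof.
elim: t b i => [|p t IH] b i; first by [].
apply/seq.permP => a; move/seq.permP/(_ a): (IH (~~ b) (i + p)%N).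
rewrite negbK /= iotaD !count_cat; case: b => /= <-.
  by rewrite block_positions_cons count_cat addnA.
by rewrite block_positions_cons count_cat addnCA.
Qed.

Lemma uniq_fern_positions b i t : uniq (block_positions (fern_blocks b i t)).
Proof.
have := iota_uniq i (sumn t); rewrite -(perm_uniq (perm_fern_positions b i t)).
by rewrite cat_uniq => /and3P[].
Qed.

Lemma fern_blocks_bounds b i t (d : nat * nat) : d \in fern_blocks b i t ->
  (i <= d.1)%N && (d.1 + d.2 <= i + sumn t)%N.
Proof.
elim: t b i => [|p t IH] b i //=.
by case: b; rewrite ?inE; first case/orP=> [/eqP ->|] /=; first lia; move=> /IH; lia.
Qed.

Lemma osum_cons p t : osum (p :: t) = (p + esum t)%N.
Proof.
rewrite /osum /esum /= big_mkcond big_ord_recl /=; congr addn.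
by rewrite [RHS]big_mkcond; apply: eq_bigr => i _; rewrite negbK.
Qed.

Lemma esum_cons p t : esum (p :: t) = osum t.
Proof.
rewrite /osum /esum /= big_mkcond big_ord_recl /= add0n.
by rewrite [RHS]big_mkcond; apply: eq_bigr => i _.
Qed.

Lemma osum_nil : osum [::] = 0%N. Proof. by rewrite /osum big_ord0. Qed.
Lemma esum_nil : esum [::] = 0%N. Proof. by rewrite /esum big_ord0. Qed.

Lemma osumDesum t : (osum t + esum t = sumn t)%N.
Proof.
elim: t => [|p t IH]; first by rewrite osum_nil esum_nil.
by rewrite osum_cons esum_cons /= -IH; lia.
Qed.

Lemma size_fern_positions b i t :
  size (block_positions (fern_blocks b i t)) = if b then osum t else esum t.
Proof.
elim: t b i => [|p t IH] b i; first by rewrite osum_nil esum_nil; case: b.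
case: b; rewrite ?osum_cons ?esum_cons /= ?block_positions_cons ?size_cat ?size_iota IH //.
Qed.

(** Needed for the right fern, whose sides are given from right to left while positions run from
    left to right; for an even length the parities of the indices are exchanged. *)
Lemma osum_rev t : osum (rev t) = if odd (size t) then osum t else esum t.
Proof.
rewrite -(size_fern_positions true 0).
have E s : size (block_positions (fern_blocks (odd (size s)) 0 (rev s))) = osum s
   /\ size (block_positions (fern_blocks (~~ odd (size s)) 0 (rev s))) = esum s.
  elim: s => [|p s [IHo IHe]]; first by rewrite osum_nil esum_nil.
  rewrite osum_cons esum_cons rev_cons -cats1 !fern_blocks_cat !block_positions_cat !size_cat.
  rewrite /= negbK IHe IHo size_rev !addNb !addbb /= !block_positions_cons !size_cat size_iota.
  by split; rewrite /block_positions /=; lia.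
by have [] := E t; case: (odd _) => /= Eo Ee.
Qed.

Lemma in_fern up (i : nat) (j : int) t c : (c \in fern up i%:Z j t) =
  has (fun d : nat * nat => c \in triangle true d.1%:Z j d.2%:Z) (fern_blocks up i t)
  || has (fun d : nat * nat => c \in triangle false d.1%:Z j d.2%:Z) (fern_blocks (~~ up) i t).
Proof.
elim: t up i => [|p t IH] up i; first by rewrite in_fset0.
rewrite [fern _ _ _ _]/(triangle up i%:Z j p%:Z `|` fern (~~ up) (i%:Z + p%:Z) j t).
rewrite in_fsetU -PoszD IH negbK; case: up => /=; first by rewrite orbA.
by rewrite orbCA.
Qed.

Lemma vdm_shift s xs : vdm [seq (s + i)%N | i <- xs] = vdm xs.
Proof.
rewrite /vdm big_map; apply: eq_bigr => i _; rewrite big_map.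
by apply: eq_big => [j|j _]; rewrite ?ltn_add2l ?subnDl.
Qed.

Lemma fern_positions_shift b s i t : block_positions (fern_blocks b (s + i) t) =
  [seq (s + j)%N | j <- block_positions (fern_blocks b i t)].
Proof.
elim: t b i => [|p t IH] b i //=.
by case: b; rewrite ?block_positions_cons ?map_cat -addnA IH //= iotaDl.
Qed.

Lemma vdm_fern_positions b i t :
  vdm (block_positions (fern_blocks b i t)) = vdm (block_positions (fern_blocks b 0 t)).
Proof. by rewrite -[i]addn0 fern_positions_shift vdm_shift. Qed.

(** * Vandermonde products of intervals *)

Lemma hyperfactS n : hyperfact n.+1 = (hyperfact n * n`!)%N.
Proof. by rewrite /hyperfact big_ord_recr. Qed.

Lemma hyperfact_gt0 n : (0 < hyperfact n)%N.
Proof. by rewrite prodn_gt0 // => i; apply: fact_gt0. Qed.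

Lemma prod_iota_sub p q : (p <= q)%N -> (\prod_(i <- iota 0 p) (q - i) = q ^_ p)%N.
Proof. by move=> pq; rewrite ffact_prod -(big_mkord xpredT (fun i => q - i)%N) /index_iota subn0. Qed.

Lemma vdm_iota i p : vdm (iota i p) = hyperfact p.
Proof.
rewrite -[i]addn0 iotaDl vdm_shift.
elim: p => [|p IH]; first by rewrite /vdm big_nil /hyperfact big_ord0.
rewrite -addn1 iotaD vdm_cat; last by rewrite -iotaD iota_uniq.
rewrite IH add0n addn1 hyperfactS /= {1}/vdm big_seq1 big_cons ltnn big_nil muln1.
congr muln; rewrite /cross -ffactnn -prod_iota_sub //.
by apply: eq_big_seq => j; rewrite mem_iota big_seq1; lia.
Qed.

(** A new position q = p+g+n is at distances q, q-1, ..., q-p+1 from 0, ..., p-1 and contributes a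
    falling factorial, which times (g+n)! is q!; so one factorial is added to each hyperfactorial
    that grows. *)
Lemma cross_iota p g n :
  (cross (iota 0 p) (iota (p + g) n) * (hyperfact (p + g) * hyperfact (g + n))
   = hyperfact (p + g + n) * hyperfact g)%N.
Proof.
elim: n => [|n IH].
  by rewrite !addn0 /cross big1 ?mul1n // => i _; rewrite big_nil.
have -> : cross (iota 0 p) (iota (p + g) n.+1) =
    (cross (iota 0 p) (iota (p + g) n) * (p + g + n) ^_ p)%N.
  rewrite /cross -(addn1 n) iotaD -prod_iota_sub; last lia.
  rewrite -big_split /=; apply: eq_big_seq => i; rewrite mem_iota => Hi.
  by rewrite big_cat /= big_seq1; congr muln; lia.
have pq : (p <= p + g + n)%N by rewrite -addnA leq_addr.
have := ffact_fact pq; rewrite -{2}addnA addKn => E.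
rewrite !addnS !hyperfactS -E.
move: IH; move: (cross _ _) (hyperfact (p + g)) (hyperfact (g + n)) (hyperfact (p + g + n)) => A B C D.
move: (hyperfact g) ((_ ^_ _)%N) ((g + n)`!)%N => F G K IH.
transitivity (A * (B * C) * (G * K))%N; first by ring.
by rewrite IH; ring.
Qed.

Lemma mem_fern_blocks b s t (d : nat * nat) : reflect
  (exists2 i, (i < size t)%N & odd i != b /\ d = ((s + sumn (take i t))%N, nth 0%N t i))
  (d \in fern_blocks b s t).
Proof.
elim: t b s d => [|p t IH] b s d; first by apply: (iffP idP) => // -[].
apply: (iffP idP) => [|[[|i] /= it [ib ->]]].
- case: b => /=.
    rewrite inE => /orP[/eqP ->|/IH[i it [ib ->]]]; first by exists 0%N => //=; rewrite addn0.
    by exists i.+1 => //=; rewrite addnA; move: ib; case: (odd i).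
  move=> /IH[i it [ib ->]].
  by exists i.+1 => //=; rewrite addnA; move: ib; case: (odd i).
- by case: b ib => //= _; rewrite addn0 mem_head.
have H b' : odd i != b' ->
    ((s + (p + sumn (take i t)))%N, nth 0%N t i) \in fern_blocks b' (s + p) t.
  by move=> ib'; apply/IH; exists i => //; rewrite addnA.
by case: b ib => /= ib; rewrite ?inE H ?orbT //; move: ib; case: (odd i).
Qed.

(** The region is a trapezoid with [osum t] rows whose removed triangles already block [osum t]
    positions, so no further dents are added. *)
Lemma semihex_nb_vdm t : (semihex_nb t * hyperfact (osum t))%N =
  vdm (block_positions (fern_blocks true 0 t)).
Proof.
rewrite /semihex_nb.
have -> : dented_semihexagon t =
    [fset c in dented (sumn t) (osum t) [::] | ~~ in_triangles (fern_blocks true 0 t) c].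
  apply/fsetP => c; rewrite in_fsetD in_fset_sub andbC; congr (_ && ~~ _).
    case: c => [[u v] b]; rewrite in_polygon in_dented in_nil -osumDesum.
    by case: b => /=; lia.
  apply/bigfcupP/hasP => [[i /andP[it io] ci]|[d /mem_fern_blocks[i it [io ->]] cd]].
    exists ((sumn (take i t))%N, nth 0%N t i) => //.
    apply/mem_fern_blocks; exists i; first by rewrite mem_iota in it.
    by rewrite add0n; split=> //; move: io; case: (odd i).
  by exists i => //; rewrite mem_iota it /=; move: io; case: (odd i).
rewrite tilings_nb_dented_blocks ?cats0 //.
- by rewrite size_fern_positions eqxx mul1n.
- exact: uniq_fern_positions.
- apply/allP => -[j k] dt /=; have := fern_blocks_bounds dt; have := leq_block_size dt.
  by rewrite size_fern_positions /=; lia.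
by rewrite -osumDesum leq_addr.
Qed.

(** * Cutting the two regions *)

Lemma cored_hexagon_count (x z h r C : nat) : odd x != odd z -> h = r.+1 ->
    let g := ((x + z)./2)%N in let m := (x + z + C)%N in
    let U := iota 0 h ++ iota (h + g) C in let D := iota (h + m) r in
  (tilings_nb (cored_hexagon x (h + r + z) z C) *
    (hyperfact (z + C + h) * hyperfact (z + r))
   = vdm U * vdm D * crossing_sum z (h + m + r) (U ++ D))%N.
Proof.
move=> xz hr g m U D.
have UE : block_positions [:: (0, h)%N; ((h + g)%N, C)] = U.
  by rewrite !block_positions_cons cats0.
have DE : block_positions [:: ((h + m)%N, r)] = D by rewrite block_positions_cons cats0.
rewrite -UE -DE; apply: region_count; rewrite ?UE ?DE.
- move=> u v b; rewrite /cored_hexagon.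
  (* As h + r is odd, Z is the parameter of different parity, and the core vertex lies half a unit
     southwest of the center. This puts the base of the core on the line v = -h, at distance [g]
     from the left completing interval. *)
  have -> : core_vertex x (h + r + z) z = ((h + g)%:Z, - h%:Z).
    rewrite /core_vertex (_ : odd x == odd (h + r + z)); last by rewrite hr; lia.
    rewrite (_ : (odd (h + r + z) == odd z) = false); last by rewrite hr; lia.
    by rewrite /= /g; congr pair; lia.
  rewrite in_fsetD /hexagon [X in _ && X]in_polygon [has _ _]orbF andbT.
  by case: (_ \in triangle _ _ _ _); case: b => /=; rewrite /m; lia.
- rewrite /U /D cat_uniq cat_uniq !iota_uniq !andbT andTb; apply/andP; split.
    by apply/hasPn => i; rewrite !mem_iota; lia.
  by apply/hasPn => i; rewrite mem_cat !mem_iota /m /g; lia.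
- by rewrite /m /g /=; lia.
- by rewrite /U size_cat !size_iota; lia.
- by rewrite /D size_iota addnC.
- by rewrite /m; lia.
- by rewrite /m; lia.
Qed.

Lemma polygon_eq u0 u1 v0 v1 w0 w1 u0' u1' v0' v1' w0' w1' :
    u0 = u0' -> u1 = u1' -> v0 = v0' -> v1 = v1' -> w0 = w0' -> w1 = w1' ->
  polygon u0 u1 v0 v1 w0 w1 = polygon u0' u1' v0' v1' w0' w1'.
Proof. by move=> -> -> -> -> -> ->. Qed.

(* [h] and [r] are the distances along the cutting line from the endpoints of the
   segment inside the hexagon to the extended northwest and southeast sides. *)
Lemma region_sw_count (x z h r : nat) (y : int) (a b c : seq nat) :
    ~~ odd (size b) ->
    h%:Z = y + 1 + (sumn b)%:Z - (minn (sumn a) (sumn b))%:Z ->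
    r%:Z = y + (sumn a)%:Z - (minn (sumn a) (sumn b))%:Z ->
    let g := ((x + z)./2)%N in let g' := uphalf (x + z) in
    let A := sumn a in let B := sumn b in let C := sumn c in
    let m := (x + z + A + B + C)%N in
    let U := block_positions ((0, h)%N :: fern_blocks false h a
               ++ fern_blocks true (h + A + g) c
               ++ fern_blocks false (h + A + g + C + g') (rev b)) in
    let D := block_positions ((h + m, r)%N :: fern_blocks true h a
               ++ fern_blocks false (h + A + g) c
               ++ fern_blocks true (h + A + g + C + g') (rev b)) in
  (tilings_nb (region_sw x y z a c b) *
    (hyperfact (h + esum a + osum c + osum b + z) *
     hyperfact (r + osum a + esum c + esum b + z))
   = vdm U * vdm D * crossing_sum z (h + m + r)
       (iota 0 (h + A) ++ iota (h + A + g) C ++ iota (h + A + g + C + g') (B + r)))%N.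
Proof.
move=> bo hE rE g g' A B C m U D.
have oeA := osumDesum a; have oeB := osumDesum b; have oeC := osumDesum c.
have := osumDesum (rev b); rewrite osum_rev (negPf bo) sumn_rev => oeR.
rewrite -/A -/B in hE rE oeA oeB oeR; rewrite -/C in oeC.
have gE : (g + g' = x + z)%N by rewrite /g /g'; lia.
have pUD : perm_eq (U ++ D)
    (iota 0 (h + A) ++ iota (h + A + g) C ++ iota (h + A + g + C + g') (B + r)).
  apply/seq.permP => P.
  have /seq.permP/(_ P) := perm_fern_positions false h a.
  have /seq.permP/(_ P) := perm_fern_positions true (h + A + g) c.
  have /seq.permP/(_ P) := perm_fern_positions false (h + A + g + C + g') (rev b).
  rewrite /U /D !iotaD !block_positions_cons !block_positions_cat !count_cat /=.
  rewrite (_ : h + A + g + C + g' + B = h + m)%N; last by rewrite /m -gE; lia.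
  by rewrite add0n sumn_rev -/A -/B -/C => Eb Ec Ea; lia.
rewrite -(perm_crossing_sum _ _ pUD); apply: region_count.
- move=> u v o.
  have -> : region_sw x y z a c b =
     polygon 0 (h + m + r)%N%:Z (- (h + (r + osum a + esum c + esum b + z))%N%:Z)
       ((h + esum a + osum c + osum b + z)%N%:Z - h%:Z) 0 m%:Z
     `\` (fern false h%:Z (- h%:Z) a `|` fern true (h + A + g)%N%:Z (- h%:Z) c
           `|` fern false (h + A + g + C + g')%N%:Z (- h%:Z) (rev b)).
    rewrite /region_sw /hexagon (negPf bo) -/A -/B -/C -/g.
    have levE : (z%:Z + (esum a)%:Z + (osum b)%:Z + (osum c)%:Z
      - (2 * y + z%:Z + (esum a)%:Z + (osum b)%:Z + (osum c)%:Z + `|A%:Z - B%:Z| + 1)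
      + (if A%:Z <= B%:Z then y else y + A%:Z - B%:Z)) = - h%:Z.
      by case: leP => AB; lia.
    (* As h and r are nonnegative, the segment on the line ends on the southwest side at the left
       and on the northeast side at the right, which decides the maximum and the minimum. *)
    cbv zeta; rewrite levE (_ : Order.max 0 (- - h%:Z) = h%:Z); last lia.
    rewrite (_ : h%:Z + A%:Z + g%:Z = (h + A + g)%N%:Z); last lia.
    rewrite (_ : Order.min _ _ - B%:Z = (h + A + g + C + g')%N%:Z); last lia.
    by apply: (f_equal (fun P => P `\` _)); apply: polygon_eq; rewrite ?/m; lia.
  rewrite in_fsetD !in_fsetU !in_fern [X in _ && X]in_polygon !has_cat.
  by do 6! case: (has _ _); rewrite ?andbF ?andbT.
- rewrite (perm_uniq pUD) cat_uniq cat_uniq !iota_uniq !andbT !andTb.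
  by apply/andP; split; apply/hasPn => i; rewrite ?mem_cat !mem_iota; lia.
- apply/allP => -[j k]; rewrite !mem_cat => /orP[] /or3P[] /fern_blocks_bounds /=;
    by rewrite ?sumn_rev -?/A -?/B -?/C /m; lia.
- rewrite block_positions_cons !block_positions_cat !size_cat !size_fern_positions size_iota /=; lia.
- rewrite block_positions_cons !block_positions_cat !size_cat !size_fern_positions size_iota /=.
  by rewrite osum_rev (negPf bo); lia.
- by rewrite /m; lia.
- by rewrite /m; lia.
Qed.

(** * The two semihexagons of the formula *)

Lemma take_size_rcons (T : Type) (s : seq T) x : take (size s) (rcons s x) = s.
Proof. by rewrite -cats1 take_size_cat. Qed.

(** In the upper half only up-pointing triangles are dents. The last triangles of the middle fern
    and of the right fern as listed, [cl] and [bl], both point down, so they merge with the gap [g']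
    between them into one separation. *)
Lemma upper_fern_blocks h a g c cl g' b bl : ~~ odd (size a) -> odd (size c) ->
  fern_blocks true 0 (h :: a ++ g :: c ++ (cl + g' + bl)%N :: rev b) =
  (0, h)%N :: fern_blocks false h a ++ fern_blocks true (h + sumn a + g) (rcons c cl)
    ++ fern_blocks false (h + sumn a + g + sumn (rcons c cl) + g') (rev (rcons b bl)).
Proof.
move=> /negPf ao co; rewrite /= add0n rev_rcons -cats1 !fern_blocks_cat ao /=.
rewrite fern_blocks_cat co /= cats0 sumn_cat /= addn0; congr (_ :: _ ++ _ ++ fern_blocks _ _ _).
by lia.
Qed.

(** In the lower half the dents are the down-pointing triangles, and the up-pointing [al] and [c1]
    merge with the gap [g]. Reading from left to right amounts to reflecting this half in the
    line. *)
Lemma lower_fern_blocks h a al g c1 c g' b r :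
    odd (size a) -> odd (size c) -> ~~ odd (size b) ->
  fern_blocks true h (a ++ (al + g + c1)%N :: c ++ g' :: b ++ [:: r]) =
  fern_blocks true h (rcons a al)
    ++ fern_blocks false (h + sumn (rcons a al) + g) (c1 :: c)
    ++ fern_blocks true (h + sumn (rcons a al) + g + sumn (c1 :: c) + g') b
    ++ [:: ((h + sumn (rcons a al) + g + sumn (c1 :: c) + g' + sumn b)%N, r)].
Proof.
move=> ao co /negPf bo; rewrite -cats1 !fern_blocks_cat ao /= cats0.
rewrite !fern_blocks_cat co /= !fern_blocks_cat bo /= sumn_cat /= addn0.
rewrite (_ : h + sumn a + (al + g + c1) = h + (sumn a + al) + g + c1)%N; last lia.
rewrite (_ : h + (sumn a + al) + g + c1 + sumn c = h + (sumn a + al) + g + (c1 + sumn c))%N //.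
by lia.
Qed.

Lemma upper_semihex_vdm h a g c g' b :
    ~~ odd (size a) -> (0 < size c)%N -> ~~ odd (size c) ->
    (0 < size b)%N -> ~~ odd (size b) ->
  (semihex_nb (h :: a ++ g :: take (size c).-1 c ++
      (nth 0 c (size c).-1 + g' + nth 0 b (size b).-1)%N :: rev (take (size b).-1 b))
    * hyperfact (h + esum a + osum c + osum b))%N =
  vdm (block_positions ((0, h)%N :: fern_blocks false h a
         ++ fern_blocks true (h + sumn a + g) c
         ++ fern_blocks false (h + sumn a + g + sumn c + g') (rev b))).
Proof.
move=> ao; case/lastP: c => // c cl _; case/lastP: b => [//|b bl] co _ bo.
have co' : odd (size c) by move: co; rewrite size_rcons /= negbK.
rewrite !size_rcons /= !nth_rcons !ltnn !eqxx !take_size_rcons.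
have E := upper_fern_blocks h g cl g' b bl ao co'.
rewrite -E -semihex_nb_vdm; congr (_ * hyperfact _)%N.
have := congr1 (fun bs => size (block_positions bs)) E.
rewrite size_fern_positions block_positions_cons !block_positions_cat !size_cat size_iota.
rewrite !size_fern_positions /= => ->.
have := osumDesum (rev (rcons b bl)); rewrite osum_rev (negPf bo) sumn_rev -osumDesum; lia.
Qed.

Lemma lower_semihex_vdm h a g c g' b r :
    (0 < size a)%N -> ~~ odd (size a) -> (0 < size c)%N -> ~~ odd (size c) ->
    ~~ odd (size b) ->
  (semihex_nb (take (size a).-1 a ++ (nth 0 a (size a).-1 + g + nth 0 c 0)%N :: drop 1 c
      ++ g' :: rev b ++ [:: r])
    * hyperfact (r + osum a + esum c + esum b))%N =
  vdm (block_positions (((h + sumn a + g + sumn c + g' + sumn b)%N, r) :: fern_blocks true h a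
         ++ fern_blocks false (h + sumn a + g) c
         ++ fern_blocks true (h + sumn a + g + sumn c + g') (rev b))).
Proof.
case/lastP: a => [//|a al] _ ao; case: c => // c1 c _ co bo.
have ao' : odd (size a) by move: ao; rewrite size_rcons /= negbK.
have co' : odd (size c) by move: co; rewrite /= negbK.
rewrite !size_rcons /= !nth_rcons !ltnn !eqxx take_size_rcons drop0.
have bo' : ~~ odd (size (rev b)) by rewrite size_rev.
have E := lower_fern_blocks h al g c1 g' r ao' co' bo'.
set X := block_positions (_ :: _).
(* The completing triangle [r] comes last in the semihexagon but first in the list of dents. *)
have pX : perm_eq (block_positions (fern_blocks true h
    (a ++ (al + g + c1)%N :: c ++ g' :: rev b ++ [:: r]))) X.
  rewrite E /X block_positions_cons !block_positions_cat sumn_rev.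
  rewrite [block_positions [:: _]]cats0 !catA perm_catC !catA.
  exact: perm_refl.
rewrite -(perm_vdm pX) vdm_fern_positions -semihex_nb_vdm; congr (_ * hyperfact _)%N.
have := perm_size pX; rewrite size_fern_positions => ->.
rewrite /X block_positions_cons !block_positions_cat !size_cat size_iota !size_fern_positions /=.
by rewrite osum_rev (negPf bo) esum_cons; lia.
Qed.

(** [W] is the common sum over [S] and [X] the product of distances between the left interval and
    the core. Solving the second equation for [W] inverts only hyperfactorials and [X], which the
    first equation makes nonzero. *)
Lemma eliminate_crossing_sum (F : fieldType)
    (X W hp hq hr hg hh hc h0 k1 k2 s1 s2 n1 n2 N1 N2 M Mc : F) :
    hp != 0 -> hq != 0 -> hr != 0 -> hg != 0 -> hh != 0 -> hc != 0 -> h0 != 0 ->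
    N1 != 0 -> N2 != 0 ->
    X * (hp * hq) = hr * hg -> Mc * (k1 * k2) = hh * hc * X * h0 * W ->
    M * (N1 * N2) = s1 * n1 * (s2 * n2) * W ->
  M = Mc * s1 * s2 * (hq / (hc * hg)) * (hp / hr) * (k2 * k1 / (N1 * N2))
      * (n1 * n2 / (h0 * hh)).
Proof.
move=> p0 q0 r0 g0 hh0 c0 h00 N10 N20 E1 E2 E3.
have XE : X = hr * hg / (hp * hq) by rewrite -E1 mulfK // mulf_neq0.
have -> : M = s1 * n1 * (s2 * n2) * W / (N1 * N2) by rewrite -E3 mulfK // mulf_neq0.
have -> : W = Mc * (k1 * k2) / (hh * hc * X * h0).
  by rewrite E2 XE; field; rewrite p0 q0 r0 g0 hh0 c0 h00.
by rewrite XE; field; rewrite p0 q0 r0 g0 hh0 c0 h00 N10 N20.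
Qed.

Theorem theorem2p5 (x z : nat) (y : int) (a b c : seq nat)
    (hxz : odd x != odd z)
    (ha0 : (0 < size a)%N) (ha : ~~ odd (size a))
    (hb0 : (0 < size b)%N) (hb : ~~ odd (size b))
    (hc0 : (0 < size c)%N) (hc : ~~ odd (size c))
    (hy : (sumn a <= sumn b)%N -> 0 <= y)
    (hy' : (sumn b < sumn a)%N -> -1 <= y) :
  let m := size a in let n := size b in let k := size c in
  let A := sumn a in let B := sumn b in let C := sumn c in
  let g := ((x + z)./2)%N in
  let g' := uphalf (x + z)%N in
  let mu := maxn A B in
  let nu := minn A B in
  let oa := (osum a)%:Z in let ob := (osum b)%:Z in
  let oc := (osum c)%:Z in let ec := (esum c)%:Z in
  (* all the integers to which H is applied are nonnegative *)
  let H (i : int) : rat := (hyperfact (absz i))%:R in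
  (tilings_nb (region_sw x y z a c b))%:R =
    (tilings_nb (cored_hexagon x (absz (2 * y + z%:Z + 2 * mu%:Z + 1)%R) z C))%:R
    * (semihex_nb (absz (y + 1 + B%:Z - nu%:Z)%R :: a ++ g :: take k.-1 c
         ++ (nth 0 c k.-1 + g' + nth 0 b n.-1)%N :: rev (take n.-1 b)))%:R
    * (semihex_nb (take m.-1 a ++ (nth 0 a m.-1 + g + nth 0 c 0)%N :: drop 1 c
         ++ g' :: rev b ++ [:: absz (y + A%:Z - nu%:Z)%R]))%:R
    * (H (C%:Z + g%:Z) / (H C%:Z * H g%:Z))
    * (H (mu%:Z + y + g'%:Z) / H (mu%:Z + C%:Z + y + g'%:Z))
    * (H (mu%:Z + y + z%:Z) * H (mu%:Z + C%:Z + y + z%:Z + 1)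
       / (H (mu%:Z - oa + ob + oc + y + z%:Z + 1)
          * H (mu%:Z + oa - ob + ec + y + z%:Z)))
    * (H (mu%:Z - oa + ob + oc + y + 1) * H (mu%:Z + oa - ob + ec + y)
       / (H (mu%:Z + y) * H (mu%:Z + y + 1))) :> rat.
Proof.
move=> m n k A B C g g' mu nu oa ob oc ec H.
have gE : g' = g.+1 by rewrite /g /g'; lia.
have xzE : (x + z = g + g')%N by rewrite /g /g'; lia.
have oeA := osumDesum a; have oeB := osumDesum b; have oeC := osumDesum c.
rewrite -/A -/B in oeA oeB hy hy'; rewrite -/C in oeC.
have muE : (mu + nu = A + B)%N by rewrite /mu /nu; lia.
have nuA : (nu <= A)%N by rewrite /nu; lia.
have nuB : (nu <= B)%N by rewrite /nu; lia.
have hy0 : 0 <= y + 1 + B%:Z - nu%:Z by rewrite /nu; lia.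
have ry0 : 0 <= y + A%:Z - nu%:Z by rewrite /nu; lia.
have [h hE] : exists h : nat, h%:Z = y + 1 + B%:Z - nu%:Z.
  by exists (absz (y + 1 + B%:Z - nu%:Z)%R); lia.
have [r rE] : exists r : nat, r%:Z = y + A%:Z - nu%:Z.
  by exists (absz (y + A%:Z - nu%:Z)%R); lia.
rewrite -hE -rE !absz_nat.
have HE (i : int) (j : nat) : i = j%:Z -> H i = (hyperfact j)%:R by move=> ->.
set h0 := (h + A)%N; set r0 := (B + r)%N.
have h0r0 : h0 = r0.+1 by rewrite /h0 /r0; lia.
set n1 := (h + esum a + osum c + osum b)%N.
set n2 := (r + osum a + esum c + esum b)%N.
(* This is Y = 2y+z+2mu+1, because [h0] = mu+y+1 and [r0] = mu+y. *)
rewrite (_ : absz _ = (h0 + r0 + z)%N); last by rewrite /h0 /r0; lia.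
(* Each argument of H is now identified as a number of rows ([n1 + z], [n2 + z], [z + C + h0],
   [z + r0]), a number of dents ([n1], [n2]), or a length on the line of the cored hexagon. *)
rewrite (HE _ (g + C)%N); last lia.
rewrite (HE _ C) // (HE _ g) //.
rewrite (HE _ (h0 + g)%N); last by rewrite /h0; lia.
rewrite (HE _ (h0 + g + C)%N); last by rewrite /h0; lia.
rewrite (HE _ (z + r0)%N); last by rewrite /r0; lia.
rewrite (HE _ (z + C + h0)%N); last by rewrite /h0; lia.
rewrite (HE _ (n1 + z)%N); last by rewrite /n1 /oa /ob /oc; lia.
rewrite (HE _ (n2 + z)%N); last by rewrite /n2 /oa /ob /ec; lia.
rewrite (HE _ n1); last by rewrite /n1 /oa /ob /oc; lia.
rewrite (HE _ n2); last by rewrite /n2 /oa /ob /ec; lia.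
rewrite (HE _ r0); last by rewrite /r0; lia.
rewrite (HE _ h0); last by rewrite /h0; lia.
have := @region_sw_count x z h r y a b c hb hE rE; rewrite /= -/g -/g' -/A -/B -/C.
have := @upper_semihex_vdm h a g c g' b ha hc0 hc hb0 hb.
have := @lower_semihex_vdm h a g c g' b r ha0 ha hc0 hc hb.
have := @cored_hexagon_count x z h0 r0 C hxz h0r0; rewrite /= -/g.
rewrite -/A -/B -/C -/m -/n -/k -/n1 -/n2 -/h0.
(* The blocked positions of the region are rewritten as those of the cored hexagon, so that both
   counts contain the same [crossing_sum]. *)
rewrite (_ : h0 + g + C + g' = h0 + (x + z + C))%N; last lia.
rewrite (_ : h0 + (x + z + C) + B = h + (x + z + A + B + C))%N; last by rewrite /h0; lia.
rewrite (_ : h + (x + z + A + B + C) + r = h0 + (x + z + C) + r0)%N; last by rewrite /h0 /r0; lia.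
rewrite (catA (iota 0 h0)) -/r0; set W := crossing_sum _ _ _.
rewrite vdm_cat; last first.
  by rewrite cat_uniq !iota_uniq andbT /=; apply/hasPn => i; rewrite !mem_iota; lia.
rewrite !vdm_iota; set vD := vdm (block_positions _); set vU := vdm (block_positions _).
have := cross_iota h0 g C; set X := cross _ _.
set s2 := semihex_nb _; set s1 := semihex_nb _.
set Mc := tilings_nb (cored_hexagon _ _ _ _); set M := tilings_nb (region_sw _ _ _ _ _ _).
move=> E1 E2 E3 E4; rewrite -E3 -E4 => E5.
move: E1 E2 E5 => /(congr1 (fun i => i%:R : rat)) E1 /(congr1 (fun i => i%:R : rat)) E2.
move=> /(congr1 (fun i => i%:R : rat)) E5; rewrite !natrM in E1 E2 E5.
have nz i : (hyperfact i)%:R != 0 :> rat by rewrite pnatr_eq0 -lt0n hyperfact_gt0.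
apply: (@eliminate_crossing_sum _ X%:R W%:R); rewrite ?nz //.
Qed.
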